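(* Let $\mathcal{A}$ be a line arrangement in $\mathbb{P}^2$ (over $\mathbb{C}$) containing at least $3$ lines. Then $$0\leq t(\mathcal{A})\leq \deg(\mathcal{A})-3.$$ Conversely, for any integers $t$ and $d$ such that $0\leq t\leq d-3$, there are line arrangements $\mathcal{A}$ in $\mathbb{P}^2$ such that $t(\mathcal{A})=t$ and $\deg(\mathcal{A})=d$.
   Context: A line arrangement is a finite set of distinct lines in $\mathbb{P}^2=\mathbb{P}^2_{\mathbb{C}}$, identified with the reduced curve given by their union; its degree is the number of lines. Let $S=\mathbb{C}[x,y,z]$ with its standard grading. For a reduced curve $C:f=0$ of degree $d$ in $\mathbb{P}^2$, let $$D_0(f)=\{(a,b,c)\in S^3 : af_x+bf_y+cf_z=0\}$$ be the graded $S$-module of Jacobian syzygies, where a homogeneous element $(a,b,c)$ has degree $k$ if $a,b,c$ are homogeneous of degree $k$. If $d_1\leq d_2\leq\dots\leq d_m$ are the degrees of the elements of a minimal system of homogeneous generators of $D_0(f)$, the type of $C$ is the integer $t(C)=d_1+d_2+1-d$. *)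

(* Defs.v *)
From HB Require Import structures.
From mathcomp Require Import all_boot all_order all_algebra.
From mathcomp Require Import finmap complex mpoly.
From mathcomp Require Import classical_sets reals.

Set Implicit Arguments.
Unset Strict Implicit.
Unset Printing Implicit Defensive.

Import GRing.Theory Num.Theory.
Local Open Scope ring_scope.

Section Curves.
Variable R : realType.

(* C = R[i], the complex numbers over the reals R. *)
Local Notation S := {mpoly R[i][3]}.

Definition jacobian_syzygy (f : S) : set 'rV[S]_3 :=
  [set r : 'rV[S]_3 | \sum_(j < 3) r 0 j * f^`M(j) = 0]%classic.

Definition homog_vec (k : nat) (r : 'rV[S]_3) : Prop :=
  forall j, r 0 j \is k.-homog.

Definition generates (M : set 'rV[S]_3)
    (g : seq 'rV[S]_3) : Prop :=
  (forall r, r \in g -> M r) /\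
  (forall r, M r -> exists c : 'I_(size g) -> S,
     r = \sum_(i < size g) c i *: g`_i).

Definition minimal_generators (M : set 'rV[S]_3)
    (g : seq 'rV[S]_3) : Prop :=
  generates M g /\
  (forall g', subseq g' g -> generates M g' -> g' = g).

Definition generator_degrees (M : set 'rV[S]_3)
    (ds : seq nat) : Prop :=
  exists g : seq 'rV[S]_3,
    [/\ minimal_generators M g,
        size ds = size g,
        forall i, (i < size g)%N -> homog_vec (nth 0%N ds i) g`_i &
        sorted leq ds].

(* (msize f).-1 is the degree of f. *)
Definition has_type (f : S) (t : int) : Prop :=
  exists d1 d2 : nat, exists ds : seq nat,
    generator_degrees (jacobian_syzygy f) [:: d1, d2 & ds] /\
    t = d1%:Z + d2%:Z + 1 - ((msize f).-1)%:Z.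

(* The type does not depend on the minimal system of generators.  The default
   value -1 is returned when D_0(f) has no minimal system of at least two
   homogeneous generators, which does not happen for reduced curves. *)
Definition curve_type (f : S) : int :=
  xget (-1) [set t | has_type f t]%classic.

(* P^2 is the projectivization of C^3: its lines are the planes of C^3. *)
Definition line : Type := {L : {vspace 'rV[R[i]]_3} | \dim L == 2%N}.
HB.instance Definition _ := Choice.on line.

Definition defines_line (L : line) (l : S) : Prop :=
  l \is 1.-homog /\
  (forall v : 'rV[R[i]]_3, v \in val L <-> l.@[fun j => v 0 j] = 0).

(* Unique up to a nonzero scalar, which affects neither D_0 nor the type. *)
Definition line_form (L : line) : S :=
  xget 0 [set l | defines_line L l]%classic.

Definition line_arrangement : Type := {fset line}.

Definition arr_deg (A : line_arrangement) : nat := #|` A|.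

Definition arr_poly (A : line_arrangement) : S :=
  \prod_(L <- A) line_form L.

Definition arr_type (A : line_arrangement) : int := curve_type (arr_poly A).

End Curves.

(* Main.v *)
From HB Require Import structures.
Require Import Defs.
From mathcomp Require Import all_boot all_order all_algebra.
From mathcomp Require Import reals.
From mathcomp Require Import finmap complex mpoly boolp classical_sets.
From mathcomp Require Import ring zify.

(** Let [f] be the product of [d] pairwise non-proportional linear forms, and let
    [euler] be the vector field (x, y, z), which multiplies [f] by [d].  A Jacobian
    syzygy [u] is a derivation killing [f]; it is tangent to every line of the
    arrangement, hence so are all combinations of [euler] and of two syzygies [u]
    and [v], and [f] divides the determinant [triple euler u v] ([saito]).  If [u]
    and [v] are independent, the determinant is nonzero, of degree one more than
    the sum of their degrees.

    This gives [0 <= t] as soon as the first two minimal generators [x] and [y] are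
    independent ([first_two_independent]).  If they were not, unique factorization
    in [S] would make both of them multiples of a single syzygy, which could not
    have lower degree than [x]; so [y] would be a multiple of [x].

    For upper bounds, a point [p] outside [e] of the lines gives a syzygy of degree
    [e] ([point_syzygy]), and distinct points give independent syzygies
    ([point_syzygy_independent]).  The sum of the degrees of two independent
    syzygies is at least the sum of the degrees of the first two generators
    ([two_generators_le]).  As soon as there are three lines, two of the points
    have multiplicities with sum at least 4 ([two_multiple_points]), whence
    [t <= (d - 2) + (d - 2) + 1 - d = d - 3].

    Conversely, [m] lines of a pencil and [t + 1] lines in general position, with
    [d = m + t + 1], have type [t].  The centre of the pencil and a double point
    give [<=].  For [>=], restrict [crossp euler u] to a line: it vanishes at the
    intersection points, because there [u] is tangent to two lines, and so it
    vanishes on the whole line when [u] has low degree ([syz_along_line]).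
    Combined with Saito's determinant this shows that no two independent syzygies
    have smaller degrees ([pencil_generic_degree]).

    That the type is defined at all requires a finite system of generators; it
    comes from Hilbert's basis theorem ([noetherian_mpoly]). *)

Set Implicit Arguments.
Unset Strict Implicit.
Unset Printing Implicit Defensive.

Import GRing.Theory Num.Theory.
Local Open Scope ring_scope.

(** * Unique factorization *)

Section Divisibility.
Variable R : idomainType.
Implicit Types (a b c p q : R) (s : seq R).

Definition divides a b := exists c, b = c * a.

Definition prime_elt p :=
  [/\ p != 0, p \isn't a GRing.unit &
      forall a b, divides p (a * b) -> divides p a \/ divides p b].

Definition factorial_ring :=
  forall a, a != 0 -> exists u s,
    [/\ u \is a GRing.unit, {in s, forall p, prime_elt p} &
        a = u * \prod_(p <- s) p].

Lemma divides_refl a : divides a a.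
Proof. by exists 1; rewrite mul1r. Qed.

Lemma divides_trans b a c : divides a b -> divides b c -> divides a c.
Proof. by move=> [x ->] [y ->]; exists (y * x); rewrite mulrA. Qed.

Lemma divides_mull a b c : divides a b -> divides a (c * b).
Proof. by move=> [x ->]; exists (c * x); rewrite mulrA. Qed.

Lemma divides_mulr a b c : divides a b -> divides a (b * c).
Proof. by rewrite mulrC; apply: divides_mull. Qed.

Lemma divides0 a : divides a 0.
Proof. by exists 0; rewrite mul0r. Qed.

Lemma dividesD a b c : divides a b -> divides a c -> divides a (b + c).
Proof. by move=> [x ->] [y ->]; exists (x + y); rewrite mulrDl. Qed.

Lemma dividesB a b c : divides a b -> divides a c -> divides a (b - c).
Proof. by move=> [x ->] [y ->]; exists (x - y); rewrite mulrBl. Qed.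

Lemma divides_unit u a : u \is a GRing.unit -> divides u a.
Proof. by move=> uu; exists (a / u); rewrite divrK. Qed.

Lemma unit_divides_unit u a :
  u \is a GRing.unit -> divides a u -> a \is a GRing.unit.
Proof. by move=> uu [c uE]; move: uu; rewrite uE unitrM => /andP[]. Qed.

Lemma prime_divides_prod p u s : prime_elt p -> u \is a GRing.unit ->
  divides p (u * \prod_(q <- s) q) -> exists2 q, q \in s & divides p q.
Proof.
move=> [p0 pU pP] uU.
have pNu : ~ divides p u by move=> /(unit_divides_unit uU); apply/negP.
elim: s => [|q s IHs]; rewrite ?big_nil ?mulr1 // big_cons mulrCA.
move=> /pP[pq|/IHs[r rs pr]]; first by exists q; rewrite ?mem_head.
by exists r; rewrite // in_cons rs orbT.
Qed.

Lemma prime_divides_sym p q :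
  prime_elt p -> prime_elt q -> divides p q -> divides q p.
Proof.
move=> [p0 pU pP] [q0 qU qP] [e qE].
have /qP[[f eE]|//] : divides q (e * p) by rewrite -qE; apply: divides_refl.
case/negP: pU; apply/unitrPr; exists f; apply: (mulIf q0).
by rewrite mul1r {2}qE eE; ring.
Qed.

(** Each prime of [s] divides the cofactor of [g], since it does not divide [g]
    itself; this is the step behind Gauss's lemma. *)
Lemma prime_prod_cancel s g a : {in s, forall p, prime_elt p} ->
  {in s, forall p, ~ divides p g} ->
  divides g (\prod_(p <- s) p * a) -> divides g a.
Proof.
elim: s => [|p s IHs] sP sg; first by rewrite big_nil mul1r.
rewrite big_cons -mulrA => -[c cE].
have [p0 pU pP] := sP p (mem_head _ _).
have /pP[[d dE]|/(sg _ (mem_head _ _)) //] : divides p (c * g).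
  by rewrite -cE; apply/divides_mulr/divides_refl.
apply: IHs => [q qs|q qs|].
  by apply: sP; rewrite in_cons qs orbT.
  by apply: sg; rewrite in_cons qs orbT.
by exists d; apply: (mulfI p0); rewrite cE dE; ring.
Qed.

(** The prime factors of [a] which divide [b] move to [g], one at a time.  The
    coprimality of [a'] and [b'] is recorded as Euclid's lemma, the only form in
    which it is used. *)
Lemma factorial_gcd a b : factorial_ring -> a != 0 ->
  exists g a' b', [/\ a = g * a', b = g * b' &
    forall c, divides a' (b' * c) -> divides a' c].
Proof.
move=> fR /fR[u [s [uU sP ->]]].
elim: s b sP => [|p s IHs] b sP.
  exists 1, u, b; rewrite big_nil !mul1r mulr1; split=> // c _.
  exact: divides_unit.
have [p0 pU pP] := sP p (mem_head _ _).
have {}sP : {in s, forall p, prime_elt p}.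
  by move=> q qs; apply: sP; rewrite in_cons qs orbT.
rewrite big_cons; have [[b1 bE]|pNb] := pselect (divides p b).
  have [g [a' [b' [aE bE' ab]]]] := IHs b1 sP.
  exists (p * g), a', b'; split=> //; last by rewrite bE bE'; ring.
  by rewrite mulrCA aE mulrA.
have [g [a' [b' [aE bE ab]]]] := IHs b sP.
exists g, (p * a'), b'; split=> // [|c [e eE]]; first by rewrite mulrCA aE; ring.
have [a0|a0] := eqVneq a' 0.
  have : divides a' (b' * c) by exists (e * p); rewrite eE; ring.
  by move=> /ab; rewrite a0 mulr0.
have [|c1 cE] := ab c; first by exists (e * p); rewrite eE; ring.
have /pP[[h bE']|[h c1E]] : divides p (b' * c1).
- by exists e; apply: (mulIf a0); rewrite -mulrA -cE eE; ring.
- by case: pNb; exists (g * h); rewrite bE bE'; ring.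
by exists h; rewrite cE c1E; ring.
Qed.

(** A prime which does not divide [p] still divides the cofactor that is left
    once [p] has been divided out of [a]. *)
Lemma prod_primes_divides s a : {in s, forall p, prime_elt p} -> uniq s ->
  {in s &, forall p q, p != q -> ~ divides p q} ->
  {in s, forall p, divides p a} -> divides (\prod_(p <- s) p) a.
Proof.
elim: s a => [|p s IHs] a sP; first by rewrite big_nil => _ _; exists a; rewrite mulr1.
rewrite big_cons => /= /andP[pNs us] sN sa.
have ss q : q \in s -> q \in p :: s by move=> qs; rewrite in_cons qs orbT.
have [b aE] : divides p a by apply/sa/mem_head.
have [||q r qs rs|q qs|c bE] // := IHs b.
- by move=> q qs; apply: sP (ss _ qs).
- by apply: sN; apply: ss.
- have [q0 qU qP] := sP q (ss _ qs).
  have : divides q (b * p) by rewrite -aE; apply/sa/ss.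
  move=> /qP[//|qp]; case: (sN q p (ss _ qs) (mem_head _ _)) => //.
  by apply: contraNneq pNs => <-.
by exists c; rewrite aE bE; ring.
Qed.

End Divisibility.

Lemma divides_rmorph (R S : idomainType) (f : {rmorphism R -> S}) a b :
  divides a b -> divides (f a) (f b).
Proof. by move=> [c ->]; exists (f c); rewrite rmorphM. Qed.

Lemma factorial_iso (R S : idomainType) (f : {rmorphism R -> S})
    (g : {rmorphism S -> R}) :
  cancel f g -> cancel g f -> factorial_ring R -> factorial_ring S.
Proof.
move=> fK gK fR a a0.
have ga0 : g a != 0 by apply: contra_neq a0 => ga0; rewrite -(gK a) ga0 rmorph0.
have [u [s [uU sP gaE]]] := fR _ ga0.
exists (f u), (map f s); split; first exact: rmorph_unit.
  move=> _ /mapP[p /sP[p0 pU pP] ->]; split.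
  - by apply: contra_neq p0 => fp0; rewrite -(fK p) fp0 rmorph0.
  - apply: contra pU => fpU; rewrite -(fK p); exact: rmorph_unit.
  move=> b c /(divides_rmorph g); rewrite fK rmorphM => /pP[] /(divides_rmorph f);
    rewrite gK; tauto.
by rewrite big_map -rmorph_prod -rmorphM -gaE gK.
Qed.

Section Gauss.
Variable R : idomainType.
Implicit Types (p : R) (P Q : {poly R}).

Lemma divides_polyC_X p P : divides p%:P (P * 'X) -> divides p%:P P.
Proof.
move=> [Q QE]; exists (\poly_(i < size Q) Q`_i.+1); apply/polyP=> i.
have := congr1 (fun P : {poly R} => P`_i.+1) QE.
rewrite coefMX /= => ->; rewrite !coefMC coef_poly; case: ltnP => // sQ.
by rewrite nth_default ?mul0r // (leq_trans sQ).
Qed.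

(** The prime divides one of the two constant terms; removing this term from its
    factor and dividing by ['X] lowers the degree. *)
Lemma prime_polyC p : prime_elt p -> prime_elt p%:P.
Proof.
move=> [p0 pU pP]; split; rewrite ?polyC_eq0 //.
  by rewrite poly_unitE coefC eqxx (negPf pU) andbF.
move=> P Q; have [n] := ubnP (size P + size Q); elim: n P Q => // n IHn P Q.
have [-> _ _|P0] := eqVneq P 0; first by left; apply: divides0.
have [-> _ _|Q0] := eqVneq Q 0; first by right; apply: divides0.
elim/poly_ind: P P0 => [|P c _ P0]; first by rewrite eqxx.
elim/poly_ind: Q Q0 => [|Q e _ Q0]; first by rewrite eqxx.
rewrite ltnS => sz pPQ.
have szX (T : {poly R}) a : T * 'X + a%:P != 0 -> (size T < size (T * 'X + a%:P)%R)%N.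
  move=> T0; rewrite size_MXaddC; case: ifP => // /andP[/eqP TE /eqP aE].
  by rewrite TE aE mul0r add0r eqxx in T0.
have : divides p (c * e).
  have [T TE] := pPQ; exists T`_0.
  have := congr1 (fun P : {poly R} => P`_0) TE; rewrite coefMC => <-.
  by rewrite coef0M !coefD !coefMX !coefC !add0r.
have fromX (T U : {poly R}) a : divides p a -> divides p%:P ((T * 'X + a%:P) * U) ->
    divides p%:P (T * U).
  move=> [b ->] pTU; apply: divides_polyC_X.
  have -> : T * U * 'X = (T * 'X + (b * p)%:P) * U - b%:P * U * p%:P.
    by rewrite polyCM; ring.
  by apply: dividesB => //; exists (b%:P * U).
have toX (T : {poly R}) a : divides p a -> divides p%:P T ->
    divides p%:P (T * 'X + a%:P).
  move=> [b ->] pT; apply: dividesD; first exact: divides_mulr.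
  by exists b%:P; rewrite polyCM.
move=> /pP[pc|pe].
  have /IHn[|pP'|pQ] := fromX _ _ _ pc pPQ; last by right.
    by apply: leq_trans sz; rewrite ltn_add2r; apply: szX.
  by left; apply: toX.
rewrite mulrC in pPQ; have := fromX _ _ _ pe pPQ; rewrite mulrC => /IHn[|pP'|pQ].
- by apply: leq_trans sz; rewrite ltn_add2l; apply: szX.
- by left.
by right; apply: toX.
Qed.

Definition primitive P := forall p, prime_elt p -> ~ divides p%:P P.

Lemma primitive_divides P Q : divides P Q -> primitive Q -> primitive P.
Proof. by move=> PQ Qp p /Qp pQ pP; apply/pQ/(divides_trans pP). Qed.

Hypothesis fR : factorial_ring R.

(** Primes dividing all coefficients divide the leading one, which has finitely
    many prime factors: each of them is divided out of [P] if it can be. *)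
Lemma primitive_part P : P != 0 -> exists c P0,
  [/\ c != 0, P = c *: P0 & primitive P0].
Proof.
have strip t u Q : {in t, forall p, prime_elt p} ->
    lead_coef Q = u * \prod_(p <- t) p -> exists c t' Q0,
    [/\ c != 0, Q = c *: Q0, lead_coef Q0 = u * \prod_(p <- t') p &
        {in t', forall p, prime_elt p /\ ~ divides p%:P Q0}].
  elim: t u Q => [|p t IHt] u Q tP QE.
    by exists 1, [::], Q; rewrite oner_neq0 scale1r.
  have pP := tP p (mem_head _ _); have [p0 pU _] := pP.
  have {}tP : {in t, forall p, prime_elt p}.
    by move=> q qt; apply: tP; rewrite in_cons qt orbT.
  rewrite big_cons in QE; have [[Q1 Q1E]|pNQ] := pselect (divides p%:P Q).
    have [|c [t' [Q0 [c0 Q0E lQ0 t'P]]]] := IHt u Q1 tP.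
      by apply: (mulIf p0); rewrite -{1}(lead_coefC p) -lead_coefM -Q1E QE; ring.
    exists (p * c), t', Q0; split=> //; first by rewrite mulf_neq0.
    by rewrite Q1E Q0E -!mul_polyC polyCM; ring.
  rewrite mulrA in QE; have [c [t' [Q0 [c0 Q0E lQ0 t'P]]]] := IHt _ _ tP QE.
  exists c, (p :: t'), Q0; split=> //; first by rewrite lQ0 big_cons mulrA.
  move=> q; rewrite in_cons => /predU1P[-> {q}|/t'P //]; split=> // pQ0.
  by apply: pNQ; rewrite Q0E -mul_polyC; apply: divides_mull.
move=> P0; have [|u [t [uU tP lP]]] := fR (a := lead_coef P).
  by rewrite lead_coef_eq0.
have [c [t' [Q [c0 QE lQ t'P]]]] := strip _ _ _ tP lP; exists c, Q; split=> // p pP pQ.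
have : divides p (lead_coef Q).
  by have [T ->] := pQ; rewrite lead_coefM lead_coefC; exists (lead_coef T).
rewrite lQ => /(prime_divides_prod pP uU)[q /t'P[qP qQ] pq].
apply: qQ; apply: divides_trans pQ.
by have [e ->] := prime_divides_sym pP qP pq; exists e%:P; rewrite polyCM.
Qed.

(** Gauss's lemma: the prime factors of [c] remain prime in [{poly R}] and none of
    them divides [Q]. *)
Lemma primitive_divides_scale c P Q : primitive Q -> c != 0 ->
  divides Q (c *: P) -> divides Q P.
Proof.
move=> Qp /fR[u [s [uU sP ->]]]; rewrite -mul_polyC polyCM rmorph_prod /=.
rewrite -(big_map (@polyC R) xpredT id) -mulrA => -[T TE].
apply: (@prime_prod_cancel _ [seq p%:P | p <- s]).
- by move=> _ /mapP[p /sP pP ->]; apply: prime_polyC.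
- by move=> _ /mapP[p /sP pP ->]; apply: Qp.
exists (u^-1%:P * T); rewrite -mulrA -TE !mulrA -polyCM mulVr //.
by rewrite polyC1 mul1r.
Qed.

Lemma primitive_const c : c != 0 -> primitive c%:P -> c \is a GRing.unit.
Proof.
move=> /fR[u [[|p s] [uU sP ->]]]; first by rewrite big_nil mulr1.
move=> /(_ p (sP _ (mem_head _ _)))[]; rewrite big_cons mulrCA polyCM.
exact/divides_mulr/divides_refl.
Qed.

(** If [P] does not divide [A], minimality makes their gcd constant.  Over [R]
    Bezout's identity holds only up to a nonzero constant, and Gauss's lemma
    removes that constant because [P] is primitive. *)
Lemma minimal_divisor_prime P : primitive P -> (1 < size P)%N ->
  (forall Q, divides Q P -> (1 < size Q)%N -> (size P <= size Q)%N) ->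
  prime_elt P.
Proof.
move=> Pp sP Pmin; have P0 : P != 0 by rewrite -size_poly_gt0 ltnW.
split=> //; first by rewrite poly_unitE gtn_eqF.
move=> A B PAB; have [PA|PNA] := pselect (divides P A); [by left|right].
have g0 : gcdp P A != 0 by rewrite gcdp_eq0 (negPf P0).
have [c [G [c0 gE Gp]]] := primitive_part g0.
have Gdvd Q : gcdp P A %| Q -> divides G Q.
  move=> /Pdiv.Idomain.dvdpP[[e T] /= e0 eE].
  apply: (primitive_divides_scale Gp e0); exists (c *: T).
  by rewrite eE gE -scalerAr -scalerAl.
have [T TE] := Gdvd P (dvdp_gcdl P A).
have [sG|sG] := ltnP 1 (size G).
  have GP : divides G P by exists T.
  have T0 : T != 0 by apply: contra_neq P0 => T0; rewrite TE T0 mul0r.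
  have G0 : G != 0 by rewrite -size_poly_gt0 ltnW.
  have sT : (size T <= 1)%N.
    by have := Pmin _ GP sG; rewrite TE size_mul //; lia.
  case: PNA; apply: divides_trans (Gdvd _ (dvdp_gcdr P A)).
  have TC := size1_polyC sT; have : T`_0 \is a GRing.unit.
    apply: primitive_const; first by rewrite -polyC_eq0 -TC.
    by rewrite -TC; apply: primitive_divides Pp; exists G; rewrite mulrC.
  move: T`_0 TC => t TC tU; exists (t^-1)%:P; rewrite TE TC mulrA -polyCM mulVr //.
  by rewrite polyC1 mul1r.
have /Bezout_coprimepP[[U V]] /= : coprimep P A.
  by rewrite coprimep_def gE size_scale // eqn_leq sG size_poly_gt0;
     apply: contra_neq g0 => G0; rewrite gE G0 scaler0.

move=> UV; have /size_poly1P[r r0 rE] : size (U * P + V * A) == 1%N.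
  by rewrite (eqp_size UV) size_poly1.
apply: (primitive_divides_scale Pp r0); rewrite -mul_polyC -rE mulrDl.
apply: dividesD; first by exists (U * B); ring.
by rewrite -mulrA; apply: divides_mull.
Qed.

(** The content is factored in [R]; from the primitive part one splits off
    nonconstant divisors of least degree. *)
Theorem factorial_poly : factorial_ring {poly R}.
Proof.
have prim n P : (size P < n)%N -> P != 0 -> primitive P ->
    exists (u : {poly R}) (s : seq {poly R}),
    [/\ u \is a GRing.unit, {in s, forall Q, prime_elt Q} &
        P = u * \prod_(Q <- s) Q].
  elim: n P => // n IHn P sn P0 Pp; have [sP|sP] := leqP (size P) 1.
    exists P, [::]; rewrite big_nil mulr1; split=> //.
    rewrite (size1_polyC sP) rmorph_unit //; apply: primitive_const.
      by rewrite -polyC_eq0 -size1_polyC.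
    by rewrite -size1_polyC.
  have exQ : exists m, `[< exists Q, [/\ divides Q P, (1 < size Q)%N & size Q = m] >].
    by exists (size P); apply/asboolP; exists P; split=> //; apply: divides_refl.
  case: (ex_minnP exQ) => m /asboolP[Q [QP sQ <-]] Qmin.
  have QpE : prime_elt Q.
    apply: minimal_divisor_prime => //; first exact: primitive_divides Pp.
    move=> T TQ sT; apply: Qmin; apply/asboolP; exists T; split=> //.
    exact: divides_trans QP.
  have [T TE] := QP; have T0 : T != 0.
    by apply: contra_neq P0 => T0; rewrite TE T0 mul0r.
  have [||u [s [uU sP' TE']]] := IHn T _ T0.
  - by move: sn; rewrite TE size_mul //; [lia | case: QpE].
  - by apply: primitive_divides Pp; exists Q; rewrite mulrC.
  exists u, (Q :: s); split=> //; last by rewrite TE TE' big_cons; ring.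
  by move=> q; rewrite in_cons => /predU1P[->|/sP'].
move=> P P0; have [c [Q [c0 QE Qp]]] := primitive_part P0.
have Q0 : Q != 0 by apply: contra_neq P0 => Q0; rewrite QE Q0 scaler0.
have [u [s [uU sP sE]]] := prim _ _ (ltnSn _) Q0 Qp.
have [v [t [vU tP tE]]] := fR c0.
exists (v%:P * u), ([seq p%:P | p <- t] ++ s); split.
- by rewrite unitrM uU rmorph_unit.
- move=> p; rewrite mem_cat => /orP[/mapP[q /tP qP ->]|/sP //].
  exact: prime_polyC.
rewrite big_cat big_map /= QE sE -mul_polyC tE polyCM rmorph_prod; ring.
Qed.

End Gauss.

Lemma factorial_field (F : fieldType) : factorial_ring F.
Proof. by move=> a a0; exists a, [::]; rewrite big_nil mulr1 unitfE. Qed.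

(** * Finite generation *)

Section FinitelyGenerated.
Variable R : nzRingType.

Definition submodule (V : lmodType R) (M : V -> Prop) :=
  M 0 /\ forall a x y, M x -> M y -> M (a *: x + y).

(** The intersection of all submodules containing [s]: to prove something about
    all linear combinations, one exhibits a submodule. *)
Definition lspan (V : lmodType R) (s : seq V) (x : V) :=
  forall M, submodule M -> {in s, forall y, M y} -> M x.

Definition fin_gen (V : lmodType R) (M : V -> Prop) :=
  exists2 s : seq V, {in s, forall x, M x} & forall x, M x -> lspan s x.

Section Submodule.
Variables (V : lmodType R) (M : V -> Prop).
Hypothesis Msub : submodule M.

Lemma submodule0 : M 0. Proof. by case: Msub. Qed.

Lemma submoduleD x y : M x -> M y -> M (x + y).
Proof. by rewrite -{2}[x]scale1r; case: Msub => _; apply. Qed.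

Lemma submoduleZ a x : M x -> M (a *: x).
Proof.
by move=> Mx; rewrite -[_ *: _]addr0; case: Msub => M0; apply.
Qed.

Lemma submoduleB x y : M x -> M y -> M (x - y).
Proof.
by move=> Mx My; rewrite -scaleN1r; apply: submoduleD => //; apply: submoduleZ.
Qed.

Lemma submodule_sum (I : Type) (r : seq I) (P : pred I) (F : I -> V) :
  (forall i, P i -> M (F i)) -> M (\sum_(i <- r | P i) F i).
Proof.
by move=> MF; elim/big_ind: _ => //; [apply: submodule0 | apply: submoduleD].
Qed.

End Submodule.

Lemma lspan_submodule (V : lmodType R) (s : seq V) : submodule (lspan s).
Proof.
split=> [M [M0 _] _ //|a x y sx sy M Msub sM].
by case: (Msub) => _; apply; [apply: sx | apply: sy].
Qed.

Lemma mem_lspan (V : lmodType R) (s : seq V) x : x \in s -> lspan s x.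
Proof. by move=> xs M _; apply. Qed.

Lemma lspan_trans (V : lmodType R) (s t : seq V) x :
  {in s, forall y, lspan t y} -> lspan s x -> lspan t x.
Proof. by move=> st /(_ (lspan t) (lspan_submodule t)); apply. Qed.

Lemma lspan_sub (V : lmodType R) (s t : seq V) x :
  {subset s <= t} -> lspan s x -> lspan t x.
Proof. by move=> st; apply: lspan_trans => y /st; apply: mem_lspan. Qed.

Lemma submodule_preim (V W : lmodType R) (f : {linear V -> W}) M :
  submodule M -> submodule (fun v => M (f v)).
Proof.
by move=> [M0 MP]; split=> [|a x y]; rewrite ?linear0 // linearP; apply: MP.
Qed.

Lemma submodule_image (V W : lmodType R) (f : {linear V -> W}) M :
  submodule M -> submodule (fun w => exists2 v, M v & f v = w).
Proof.
move=> [M0 MP]; split=> [|a _ _ [x Mx <-] [y My <-]].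
  by exists 0; rewrite ?linear0.
by exists (a *: x + y); [apply: MP | rewrite linearP].
Qed.

Lemma lspan_map (V W : lmodType R) (f : {linear V -> W}) s x :
  lspan s x -> lspan (map f s) (f x).
Proof.
move=> sx; apply: (sx (fun v => lspan (map f s) (f v))).
  exact/submodule_preim/lspan_submodule.
by move=> y ys; apply: mem_lspan; apply: map_f.
Qed.

(** Generators of the image are lifted and completed by generators of the
    kernel. *)
Lemma fin_gen_ext (V W : lmodType R) (f : {linear V -> W}) M : submodule M ->
  fin_gen (fun w => exists2 v, M v & f v = w) ->
  fin_gen (fun v => M v /\ f v = 0) -> fin_gen M.
Proof.
move=> Msub [s sM sP] [t tM tP].
have /choice[g gP] : forall w, exists v, w \in s -> M v /\ f v = w.
  move=> w; have [ws|] := boolP (w \in s); last by exists 0.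
  by have [v] := sM w ws; exists v.
have gM : {in map g s, forall v, M v} by move=> _ /mapP[w /gP[? _] ->].
exists (map g s ++ t).
  by move=> x; rewrite mem_cat => /orP[/gM //|/tM[]].
move=> x Mx; have [y sy fyx] : exists2 y, lspan (map g s) y & f y = f x.
  have sfx : lspan s (f x) by apply: sP; exists x.
  apply: (sfx (fun w => exists2 y, lspan (map g s) y & f y = w)).
    exact/submodule_image/lspan_submodule.
  by move=> w ws; exists (g w); [by apply: mem_lspan; apply: map_f | case: (gP w ws)].
rewrite -(subrK y x); apply: (submoduleD (lspan_submodule _)); last first.
  by apply: lspan_sub sy => z; rewrite mem_cat => ->.
apply: (@lspan_sub _ t); first by move=> z; rewrite mem_cat orbC => ->.
apply: tP; split; last by rewrite linearB fyx subrr.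
by apply: submoduleB => //; apply: sy.
Qed.

Definition noetherian := forall I : R^o -> Prop, submodule I -> fin_gen I.

(** The first coordinate maps [M] onto an ideal, with a module of shorter rows as
    its kernel. *)
Lemma fin_gen_row n (M : 'rV[R]_n -> Prop) :
  noetherian -> submodule M -> fin_gen M.
Proof.
move=> nR; elim: n M => [|n IHn] M Msub.
  by exists [::] => // x _ N [N0 _] _; rewrite thinmx0.
pose hd (v : 'rV[R]_(1 + n)) : R^o := v 0 0.
have hd_lin : linear hd by move=> a u v; rewrite /hd !mxE.
pose hdL := GRing.isLinear.Build R 'rV[R]_(1 + n) R^o *:%R hd hd_lin.
pose HD : {linear 'rV[R]_(1 + n) -> R^o} := HB.pack hd hdL.
pose inj (w : 'rV[R]_n) : 'rV[R]_(1 + n) := row_mx 0 w.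
have inj_lin : linear inj.
  by move=> a u v; rewrite /inj scale_row_mx add_row_mx scaler0 addr0.
pose injL := GRing.isLinear.Build R 'rV[R]_n 'rV[R]_(1 + n) *:%R inj inj_lin.
pose INJ : {linear 'rV[R]_n -> 'rV[R]_(1 + n)} := HB.pack inj injL.
apply: (fin_gen_ext (f := HD) Msub).
  by apply: nR; apply: submodule_image.
have [s sM sP] := IHn (fun w => M (INJ w)) (submodule_preim INJ Msub).
exists (map INJ s).
  move=> _ /mapP[w /sM Mw ->]; split=> //=.
  rewrite /hd /inj; have -> : 0 = lshift n (0 : 'I_1) by apply: val_inj.
  by rewrite row_mxEl mxE.
move=> x [Mx hx]; have xE : x = INJ (rsubmx x).
  rewrite /= /inj -[LHS](@hsubmxK _ 1 1 n); congr row_mx.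
  apply/rowP=> j; rewrite !mxE ord1; move: hx; rewrite /= /hd => hx.
  by rewrite -[RHS]hx; congr (x _ _); apply: val_inj.
by rewrite xE; apply: lspan_map; apply: sP; rewrite -xE.
Qed.

End FinitelyGenerated.

Lemma noetherian_surj (R S : nzRingType) (f : {rmorphism R -> S}) :
  (forall y, exists x, f x = y) -> noetherian R -> noetherian S.
Proof.
move=> fS nR J [J0 JP]; have [|s sJ sP] := nR (fun x => J (f x)).
  by split=> [|a x y]; rewrite ?rmorph0 // rmorphD rmorphM; apply: JP.
exists (map f s); first by move=> _ /mapP[x /sJ Jx ->].
move=> y Jy M [M0 MP] sM; have [x xE] := fS y; rewrite -xE.
rewrite -xE in Jy; apply: (sP x Jy (fun x => M (f x))).
  by split=> [|a u v]; rewrite ?rmorph0 // rmorphD rmorphM; apply: MP.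
by move=> u us; apply/sM/map_f.
Qed.

Lemma noetherian_field (F : fieldType) : noetherian F.
Proof.
move=> I [I0 IP]; have [[x [Ix x0]]|nI] := pselect (exists x, I x /\ x != 0).
  exists [:: x]; first by move=> y; rewrite inE => /eqP->.
  move=> y Iy; have -> : y = (y / x : F) *: x by rewrite /GRing.scale /= divfK.
  by apply: (submoduleZ (lspan_submodule _)); apply: mem_lspan; rewrite inE.
exists [::] => // x Ix M [M0 _] _; have [-> //|x0] := eqVneq x 0.
by case: nI; exists x.
Qed.

(** Hilbert's basis theorem.  The leading coefficients of the elements of [I]
    form an ideal; generators of it come from polynomials of one size [N.+1].
    Modulo these, every element of [I] has size at most [N], and such elements
    of [I] form a submodule of ['rV[R]_N]. *)
Theorem noetherian_poly (R : comNzRingType) : noetherian R -> noetherian {poly R}.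
Proof.
move=> nR I Isub.
pose L (k : nat) (a : R) := exists f, [/\ I f, (size f <= k.+1)%N & f`_k = a].
have LX k a : L k a -> L k.+1 a.
  move=> [f [If sf <-]]; exists ('X * f); split; rewrite ?coefXM //.
    exact: (submoduleZ Isub).
  have [->|f0] := eqVneq f 0; first by rewrite mulr0 size_poly0.
  by rewrite mulrC size_mulX.
have Lle k l a : (k <= l)%N -> L k a -> L l a.
  by move=> /subnK <-; elim: (l - k)%N => // m IHm /IHm /LX.
have Lsub k : submodule (L k : R^o -> Prop).
  split; first by exists 0; rewrite size_poly0 coef0; split=> //; apply: submodule0.
  move=> a _ _ [f [If sf <-]] [g [Ig sg <-]].
  exists (a *: f + g); rewrite coefD coefZ; split=> //.
    by rewrite -mul_polyC; case: Isub => _; apply.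
  rewrite (leq_trans (size_polyD _ _)) // geq_max sg andbT.
  by rewrite (leq_trans (size_scale_leq _ _)).
have Lsub' : submodule ((fun a => exists k, L k a) : R^o -> Prop).
  split; first by exists 0%N; apply: (submodule0 (Lsub _)).
  move=> a x y [k kx] [l ly]; exists (maxn k l); case: (Lsub (maxn k l)) => _; apply.
    by apply: Lle kx; rewrite leq_maxl.
  by apply: Lle ly; rewrite leq_maxr.
have [s sL sP] := nR _ Lsub'.
have [N NP] : exists N, {in s, forall a, L N a}.
  elim: s sL {sP} => [|a s IHs] sL; first by exists 0%N.
  have [N NP] := IHs (fun x xs => sL x (@mem_behead _ (a :: s) x xs)).
  have [k kP] := sL a (mem_head _ _); exists (maxn k N) => x.
  rewrite in_cons => /predU1P[->|/NP]; first by apply: Lle kP; rewrite leq_maxl.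
  by apply: Lle; rewrite leq_maxr.
have /choice[F FP] : forall a, exists f, a \in s ->
    [/\ I f, (size f <= N.+1)%N & f`_N = a].
  by move=> a; have [/NP[f fP]|] := boolP (a \in s); [exists f | exists 0].
have [|t tI tP] := @fin_gen_row R N (fun v => I (rVpoly v)) nR.
  split=> [|a x y Ix Iy]; first by rewrite linear0; apply: (submodule0 Isub).
  by rewrite linearD linearZ /= -mul_polyC; case: Isub => _; apply.
pose G : seq {poly R}^o := map F s ++ map rVpoly t.
have GI : {in G, forall f, I f}.
  move=> f; rewrite mem_cat => /orP[/mapP[a /FP[If _ _] ->//]|/mapP[v /tI Iv ->//]].
have sF a : a \in s -> lspan G (F a).
  by move=> als; apply: mem_lspan; rewrite mem_cat (map_f F als).
have sT v : v \in t -> lspan G (rVpoly v).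
  by move=> vt; apply: mem_lspan; rewrite mem_cat (map_f rVpoly vt) orbT.
have Gsub := lspan_submodule G.
exists G => // f; have [n] := ubnP (size f).
elim: n f => // n IHn f; rewrite ltnS => sf If.
have [fN|fN] := leqP (size f) N.
  rewrite -(poly_rV_K fN); apply: (tP (poly_rV f) _ (fun v => lspan G (rVpoly v))).
  - by rewrite poly_rV_K.
  - split=> [|a x y Ix Iy]; first by rewrite linear0; apply: (submodule0 Gsub).
    by rewrite linearD linearZ /= -mul_polyC; case: Gsub => _; apply.
  exact: sT.
have [g [gs sg gN]] : exists g : {poly R}^o,
    [/\ lspan G g, (size g <= N.+1)%N & g`_N = lead_coef f].
  apply: (sP (lead_coef f) _ (fun a => exists g : {poly R}^o,
    [/\ lspan G g, (size g <= N.+1)%N & g`_N = a])).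
  - by exists (size f).-1, f; split; rewrite ?leqSpred.
  - split; first by exists 0; rewrite size_poly0 coef0; split=> //; apply: (submodule0 Gsub).
    move=> a _ _ [p [Ip sp <-]] [g [Ig sg <-]].
    exists (a *: p + g); rewrite coefD coefZ; split=> //.
      by rewrite -mul_polyC; case: Gsub => _; apply.
    rewrite (leq_trans (size_polyD _ _)) // geq_max sg andbT.
    by rewrite (leq_trans (size_scale_leq _ _)).
  by move=> a als; have [? ? ?] := FP a als; exists (F a); split=> //; apply: sF.
pose h := 'X^(size f - N.+1) * g.
have hs : lspan G h by apply: (submoduleZ Gsub).
rewrite -[f](subrK h); apply: (submoduleD Gsub) => //.
apply: IHn; last by apply: (submoduleB Isub) => //; apply: hs.
have sh : (size h <= size f)%N.
  by rewrite (leq_trans (size_polyMleq _ _)) // size_polyXn; lia.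
apply: leq_trans sf.
have f0 : (0 < size f)%N by lia.
rewrite -(prednK f0) ltnS; apply/leq_sizeP => j; rewrite leq_eqVlt => /predU1P[<-|ltj].
  have arith m : (N < m)%N -> (m.-1 < m - N.+1)%N = false /\ (m.-1 - (m - N.+1))%N = N.
    by lia.
  by have [e1 e2] := arith _ fN; rewrite coefB coefXnM e1 e2 gN subrr.
rewrite prednK // in ltj.
by rewrite coefB !nth_default ?subrr // (leq_trans sh).
Qed.

(** Viewing the last variable as the variable of a univariate polynomial lets
    properties of rings which pass to [{poly R}] climb to [{mpoly F[n]}]. *)
Section UniToMulti.
Variables (F : fieldType) (n : nat).

Definition of_muni : {rmorphism {poly {mpoly F[n]}} -> {mpoly F[n.+1]}} :=
  (horner_eval ('X_ord_max : {mpoly F[n.+1]}) \o map_poly (@mwiden n F))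
    : {rmorphism _ -> _}.

Lemma of_muniD P Q : of_muni (P + Q) = of_muni P + of_muni Q.
Proof. exact: rmorphD. Qed.

Lemma of_muniM P Q : of_muni (P * Q) = of_muni P * of_muni Q.
Proof. exact: rmorphM. Qed.

Lemma of_muniC c : of_muni c%:P = mwiden c.
Proof. by rewrite /= map_polyC /horner_eval hornerC. Qed.

Lemma of_muniX : of_muni 'X = 'X_ord_max.
Proof. by rewrite /= map_polyX /horner_eval hornerX. Qed.

Lemma muni_max : muni ('X_ord_max : {mpoly F[n.+1]}) = 'X.
Proof.
rewrite /muni mmapX mmap1U; case: splitP => // j /= jE.
by have := ltn_ord j; rewrite -jE ltnn.
Qed.

Lemma muni_widen (i : 'I_n) :
  muni ('X_(widen_ord (leqnSn n) i) : {mpoly F[n.+1]}) = ('X_i)%:P.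
Proof.
rewrite /muni mmapX mmap1U; case: splitP => [j /= jE|j /= jE].
  by congr ('X_ _)%:P; apply: val_inj.
by have := ltn_ord i; rewrite jE ord1 addn0 ltnn.
Qed.

Lemma muni_mwiden (c : {mpoly F[n]}) : muni (mwiden c) = c%:P.
Proof.
elim/mpolyind: c => [|a m p _ _ IHp]; first by rewrite !rmorph0.
rewrite !rmorphD /= IHp mwidenZ muniZ -mul_polyC -mul_mpolyC rmorphM /=.
congr (_ * _ + _); rewrite mpolyXE_id !rmorph_prod; apply: eq_bigr => i _.
by rewrite !rmorphXn /= /mwiden mmapX mmap1U muni_widen.
Qed.

Lemma of_muniK : cancel of_muni (@muni n F).
Proof.
elim/poly_ind => [|P c IHP]; first by rewrite !rmorph0.
by rewrite of_muniD of_muniM muniD muniM IHP of_muniX of_muniC muni_max muni_mwiden.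
Qed.

Lemma muniK : cancel (@muni n F) of_muni.
Proof.
elim/mpolyind => [|a m p _ _ IHp]; first by rewrite !rmorph0.
rewrite muniD of_muniD; congr (_ + _); last exact: IHp.
rewrite muniZ -mul_polyC of_muniM of_muniC mwidenC mul_mpolyC; congr (_ *: _).
rewrite mpolyXE_id rmorph_prod (rmorph_prod of_muni); apply: eq_bigr => i _.
rewrite rmorphXn (rmorphXn of_muni); congr (_ ^+ _).
have [j ->|->] := unliftP ord_max i; last first.
  exact: etrans (congr1 of_muni muni_max) of_muniX.
have -> : lift ord_max j = widen_ord (leqnSn n) j.
  by apply: val_inj => /=; rewrite /bump leqNgt ltn_ord.
rewrite (congr1 of_muni (muni_widen j) : of_muni _ = _) of_muniC.
by rewrite /mwiden mmapX mmap1U.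
Qed.

End UniToMulti.

Theorem factorial_mpoly (F : fieldType) n : factorial_ring {mpoly F[n]}.
Proof.
elim: n => [|n IHn].
  apply: (factorial_iso (f := mpolyC 0 (R := F)) (g := mcoeff 0%MM)).
  - by move=> c; rewrite /= mcoeffC eqxx mulr1.
  - exact: mpolyKC.
  exact: factorial_field.
exact: factorial_iso (@of_muniK F n) (@muniK F n) (factorial_poly IHn).
Qed.

Theorem noetherian_mpoly (F : fieldType) n : noetherian {mpoly F[n]}.
Proof.
elim: n => [|n IHn].
  apply: (noetherian_surj (f := mpolyC 0 (R := F))).
    by move=> p; exists p@_0%MM; apply: mpolyKC.
  exact: noetherian_field.
apply: (noetherian_surj (f := of_muni F n)) (noetherian_poly IHn).
by move=> p; exists (muni p); apply: muniK.
Qed.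

(** * Linear forms *)

Notation o0 := (@Ordinal 3 0 isT).
Notation o1 := (@Ordinal 3 1 isT).
Notation o2 := (@Ordinal 3 2 isT).

Lemma ord3P (P : 'I_3 -> Prop) : P o0 -> P o1 -> P o2 -> forall j, P j.
Proof.
by move=> P0 P1 P2 [[|[|[|//]]] jlt]; rewrite (bool_irrelevance jlt isT).
Qed.

Lemma sum3 (V : nmodType) (G : 'I_3 -> V) : \sum_(j < 3) G j = G o0 + G o1 + G o2.
Proof.
rewrite !big_ord_recl big_ord0 addr0 addrA.
by congr (G _ + G _ + G _); apply: val_inj.
Qed.

Section CrossProduct.
Variable T : comNzRingType.
Implicit Types u v w : 'rV[T]_3.

Definition dotp u v := \sum_(j < 3) u 0 j * v 0 j.

Definition crossp u v : 'rV[T]_3 :=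
  \row_j [:: u 0 o1 * v 0 o2 - u 0 o2 * v 0 o1;
             u 0 o2 * v 0 o0 - u 0 o0 * v 0 o2;
             u 0 o0 * v 0 o1 - u 0 o1 * v 0 o0]`_j.

Definition triple u v w := dotp (crossp u v) w.

Lemma dotpE u v : dotp u v = u 0 o0 * v 0 o0 + u 0 o1 * v 0 o1 + u 0 o2 * v 0 o2.
Proof. exact: sum3. Qed.

Lemma dotpC u v : dotp u v = dotp v u.
Proof. by rewrite !dotpE; ring. Qed.

Lemma dotpZr c u v : dotp u (c *: v) = c * dotp u v.
Proof. by rewrite !dotpE !mxE; ring. Qed.

Lemma crosspC u v : crossp u v = - crossp v u.
Proof. by apply/rowP; apply: ord3P; rewrite !mxE /=; ring. Qed.

Lemma crosspZr c u v : crossp u (c *: v) = c *: crossp u v.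
Proof. by apply/rowP; apply: ord3P; rewrite !mxE /=; ring. Qed.

Lemma crosspp u : crossp u u = 0.
Proof. by apply/rowP; apply: ord3P; rewrite !mxE /=; ring. Qed.

Lemma tripleC u v w : triple u v w = - triple u w v.
Proof. by rewrite /triple !dotpE !mxE /=; ring. Qed.

Lemma triple_rot u v w : triple u v w = triple v w u.
Proof. by rewrite /triple !dotpE !mxE /=; ring. Qed.

Lemma triple0m u v : triple u 0 v = 0.
Proof. by rewrite /triple !dotpE !mxE /=; ring. Qed.

Lemma triplem0 u v : triple u v 0 = 0.
Proof. by rewrite tripleC triple0m oppr0. Qed.

Lemma tripleZZ c d u v : triple u (c *: v) (d *: v) = 0.
Proof. by rewrite /triple !dotpE !mxE /=; ring. Qed.

Lemma triple_combination c d c' d' x u v :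
  triple x (c *: x - d *: u) (c' *: x - d' *: v) = d * d' * triple x u v.
Proof. by rewrite /triple !dotpE !mxE /=; ring. Qed.

Lemma tripleZ3 c d e u v w :
  triple (c *: u) (d *: v) (e *: w) = c * d * e * triple u v w.
Proof. by rewrite /triple !dotpE !mxE /=; ring. Qed.

Lemma cramer3 (l u v w : 'rV[T]_3) j :
  l 0 j * triple u v w = dotp l u * crossp v w 0 j + dotp l v * crossp w u 0 j
    + dotp l w * crossp u v 0 j.
Proof.
by move: j; apply: ord3P; rewrite /triple !dotpE !mxE /=; ring.
Qed.

(** A vector orthogonal to [u] and to [v] is proportional to [crossp u v]. *)
Lemma double_crossp u v w i :
  crossp (crossp u v) w 0 i = v 0 i * dotp u w - u 0 i * dotp v w.
Proof. by move: i; apply: ord3P; rewrite !dotpE !mxE /=; ring. Qed.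

Lemma crossp_crossp u v w i :
  crossp (crossp u v) (crossp u w) 0 i = triple u v w * u 0 i.
Proof. by move: i; apply: ord3P; rewrite /triple !dotpE !mxE /=; ring. Qed.

Lemma crossp_eq0P u v :
  crossp u v = 0 <-> forall i j, u 0 i * v 0 j = u 0 j * v 0 i.
Proof.
split=> [uv0|uv].
  have e0 := congr1 (fun w : 'rV_3 => w 0 o0) uv0.
  have e1 := congr1 (fun w : 'rV_3 => w 0 o1) uv0.
  have e2 := congr1 (fun w : 'rV_3 => w 0 o2) uv0.
  move: e0 e1 e2; rewrite !mxE /= => /subr0_eq e0 /subr0_eq e1 /subr0_eq e2.
  by apply: ord3P; apply: ord3P; rewrite // ?e0 ?e1 ?e2.
by apply/rowP; apply: ord3P; rewrite !mxE /= ?(uv o1 o2) ?(uv o2 o0) ?(uv o0 o1) subrr.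
Qed.

End CrossProduct.

Lemma map_crossp (T U : comNzRingType) (f : {rmorphism T -> U}) u v :
  crossp (map_mx f u) (map_mx f v) = map_mx f (crossp u v).
Proof. by apply/rowP; apply: ord3P; rewrite !mxE /= rmorphB !rmorphM. Qed.

Lemma map_dotp (T U : comNzRingType) (f : {rmorphism T -> U}) u v :
  dotp (map_mx f u) (map_mx f v) = f (dotp u v).
Proof. by rewrite !dotpE !mxE !rmorphD !rmorphM. Qed.

Lemma crossp_eq0_scale (F : fieldType) (a b : 'rV[F]_3) :
  a != 0 -> crossp a b = 0 -> exists c, b = c *: a.
Proof.
move=> /rV0Pn[j aj] /crossp_eq0P ab; exists (b 0 j / a 0 j); apply/rowP=> i.
by rewrite !mxE mulrAC; apply/(canRL (mulfK aj)); rewrite mulrC ab mulrC.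
Qed.

Section LinearForms.
Variable F : numFieldType.
Local Notation S := {mpoly F[3]}.
Implicit Types (a b p q : 'rV[F]_3) (f g h : S) (u v : 'rV[S]_3).

Lemma mpoly_gen_ind (P : S -> Prop) :
  (forall c, P c%:MP) -> (forall j, P 'X_j) -> (forall f g, P f -> P g -> P (f + g)) ->
  (forall f g, P f -> P g -> P (f * g)) -> forall f, P f.
Proof.
move=> PC PX PD PM; elim/mpolyind => [|a m f _ _ IHf]; first exact: (PC 0).
apply: (PD _ _ _ IHf); rewrite -mul_mpolyC; apply: (PM _ _ (PC _)).
rewrite mpolyXE_id; apply: big_rec => [|j g _ Pg]; first exact: (PC 1).
apply: (PM _ _ _ Pg); elim: (m j) => [|k IHk]; first exact: (PC 1).
by rewrite exprS; apply: (PM _ _ (PX j)).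
Qed.

Definition const_vec a : 'rV[S]_3 := map_mx (mpolyC 3 (R := F)) a.
Definition euler : 'rV[S]_3 := \row_j 'X_j.
Definition lform a : S := dotp (const_vec a) euler.

Lemma lformE a : lform a = \sum_(j < 3) a 0 j *: 'X_j.
Proof. by apply: eq_bigr => j _; rewrite !mxE mul_mpolyC. Qed.

Lemma lform_coef a j : (lform a)@_U_(j) = a 0 j.
Proof.
rewrite lformE raddf_sum (bigD1 j) //= mcoeffZ mcoeffXU eqxx mulr1 big1 ?addr0 //.
by move=> i ij; rewrite mcoeffZ mcoeffXU (negPf ij) mulr0.
Qed.

Lemma lform_eq0 a : (lform a == 0) = (a == 0).
Proof.
apply/eqP/eqP => [a0|->]; last by rewrite lformE big1 // => j _; rewrite mxE scale0r.
by apply/rowP=> j; rewrite -lform_coef a0 mcoeff0 mxE.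
Qed.

Lemma lform_inj : injective lform.
Proof. by move=> a b ab; apply/rowP=> j; rewrite -!lform_coef ab. Qed.

Lemma lform_homog a : lform a \is 1.-homog.
Proof.
by rewrite lformE rpred_sum // => j _; rewrite rpredZ // dhomogX /= mdeg1.
Qed.

Lemma lform_deriv a j : (lform a)^`M(j) = (a 0 j)%:MP.
Proof.
rewrite lformE raddf_sum (bigD1 j) //= mderivZ mderivX mnm1E eqxx scale1r.
rewrite -{1}[U_(j)%MM]add0m addmK mpolyX0 alg_mpolyC big1 ?addr0 // => i ij.
by rewrite mderivZ mderivX mnm1E (negPf ij) scale0r scaler0.
Qed.

Lemma lform_eval a (v : 'I_3 -> F) : (lform a).@[v] = \sum_(j < 3) a 0 j * v j.
Proof.
by rewrite lformE raddf_sum; apply: eq_bigr => j _; rewrite /= mevalZ mevalXU.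
Qed.

Lemma homog1_lform f : f \is 1.-homog -> f = lform (\row_j f@_U_(j)).
Proof.
move=> fh; apply/mpolyP=> m; have [/mdeg1P[j /eqP ->]|m1] := boolP (mdeg m == 1%N).
  by rewrite lform_coef mxE.
by rewrite (dhomog_nemf_coeff fh m1) (dhomog_nemf_coeff (lform_homog _) m1).
Qed.

Lemma msize_lform a : a != 0 -> msize (lform a) = 2.
Proof.
move=> a0; have := lform_homog a; rewrite -lform_eq0 in a0.
by move=> /dhomog_msize /(dhomog_uniq a0 (lform_homog a)) e; rewrite mpolySpred // -e.
Qed.

Lemma lform_divides a b : a != 0 -> divides (lform a) (lform b) ->
  exists c, b = c *: a.
Proof.
move=> a0; have [->|b0] := eqVneq b 0; first by exists 0; rewrite scale0r.
move=> [q qE]; have q0 : q != 0.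
  by apply: contra_neq b0 => q0; apply/eqP; rewrite -lform_eq0 qE q0 mul0r.
have /eqP := congr1 (fun f : S => msize f) qE.
rewrite msizeM ?lform_eq0 // !msize_lform // addn2 /= eqSS eq_sym.
move=> /msize_poly1P[c c0 qc]; exists c; apply/rowP=> j.
by rewrite -lform_coef qE qc mul_mpolyC mcoeffZ lform_coef mxE.
Qed.

(** Substituting for ['X_k] so that [lform a] becomes 0 is the restriction of
    polynomials to a line, written as an endomorphism of [S] so that linear forms
    restrict to linear forms of the same ring. *)
Definition restrict a k (f : S) : S :=
  mmap (mpolyC 3 (R := F)) (fun j => 'X_j - (j == k)%:R * (a 0 k)^-1 *: lform a) f.

Section Restriction.
Variables (a : 'rV[F]_3) (k : 'I_3).
Hypothesis ak : a 0 k != 0.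
Local Notation phi := (restrict a k).

Lemma restrictX j : phi 'X_j = 'X_j - (j == k)%:R * (a 0 k)^-1 *: lform a.
Proof. by rewrite /restrict mmapX mmap1U. Qed.

Lemma restrictM f g : phi (f * g) = phi f * phi g.
Proof. exact: rmorphM. Qed.

Lemma restrictD f g : phi (f + g) = phi f + phi g.
Proof. exact: rmorphD. Qed.

Lemma restrictC c : phi c%:MP = c%:MP. Proof. exact: mmapC. Qed.

Lemma restrict_lform b : phi (lform b) = lform (b - (b 0 k / a 0 k) *: a).
Proof.
have restr0 : phi 0 = 0 by rewrite -(mpolyC0 3 F) restrictC.
rewrite [in LHS]lformE (big_morph phi restrictD restr0); under eq_bigr => j _.
  rewrite -mul_mpolyC restrictM restrictC restrictX mul_mpolyC scalerBr scalerA.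
  over.
rewrite big_split /= -lformE sumrN -scaler_suml (bigD1 k) //= big1 ?addr0.
  by rewrite eqxx mul1r !lformE scaler_sumr -sumrB; apply: eq_bigr => j _;
     rewrite !mxE scalerBl scalerA.
by move=> j jk; rewrite (negPf jk) mul0r mulr0.
Qed.

Lemma restrict_self : phi (lform a) = 0.
Proof. by rewrite restrict_lform divff // scale1r subrr; apply/eqP; rewrite lform_eq0. Qed.

Lemma restrict_cong f : divides (lform a) (f - phi f).
Proof.
elim/mpoly_gen_ind: f => [c|j|f g fP gP|f g fP gP].
- by rewrite restrictC subrr; apply: divides0.
- rewrite restrictX opprB addrC subrK -mul_mpolyC.
  exact/divides_mull/divides_refl.
- by rewrite restrictD opprD addrACA; apply: dividesD.
rewrite restrictM (_ : _ - _ = (f - phi f) * g + phi f * (g - phi g)); last by ring.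
by apply: dividesD; [apply: divides_mulr | apply: divides_mull].
Qed.

Lemma restrict_eq0 f : phi f = 0 <-> divides (lform a) f.
Proof.
split=> [f0|[g ->]]; last by rewrite restrictM restrict_self mulr0.
by have := restrict_cong f; rewrite f0 subr0.
Qed.

Lemma restrict_homog d f : f \is d.-homog -> phi f \is d.-homog.
Proof.
move=> fh; rewrite /restrict /mmap big_seq rpred_sum // => m fm; rewrite -(dhomog_mf fh fm).
rewrite mul_mpolyC rpredZ //= mdegE /mmap1.
have Xh j : ('X_j - (j == k)%:R * (a 0 k)^-1 *: lform a : S) \is 1.-homog.
  by rewrite rpredB ?rpredZ ?lform_homog // dhomogX /= mdeg1.
elim/big_ind2: _ => [|x1 x2 y1 y2|j _]; first exact: dhomog1.
  exact: dhomogM.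
by have := dhomogMn (m j) (Xh j); rewrite mul1n.
Qed.

End Restriction.

(** The quotient by [lform a] embeds into the domain [S] through the restriction
    to the line. *)
Lemma lform_prime a : a != 0 -> prime_elt (lform a).
Proof.
move=> a0; have /rV0Pn[k ak] := a0; split; first by rewrite lform_eq0.
  apply/negP => lU; have : divides (lform a) 1 by apply: divides_unit.
  move/(restrict_eq0 ak); rewrite -mpolyC1 restrictC => /eqP.
  by rewrite mpolyC1 oner_eq0.
move=> f g /(restrict_eq0 ak); rewrite restrictM => /eqP.
by rewrite mulf_eq0 => /orP[] /eqP /(restrict_eq0 ak); [left|right].
Qed.

Definition nonprop a b := crossp a b != 0.

Lemma nonprop_sym a b : nonprop a b = nonprop b a.
Proof. by rewrite /nonprop crosspC oppr_eq0. Qed.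

Lemma nonprop_ndivides a b : a != 0 -> nonprop a b -> ~ divides (lform a) (lform b).
Proof.
move=> a0 /eqP ab /(lform_divides a0)[c bE]; apply: ab.
by rewrite bE crosspZr crosspp scaler0.
Qed.

Definition arr_form (s : seq 'rV[F]_3) : S := \prod_(a <- s) lform a.

Definition reduced (s : seq 'rV[F]_3) :=
  [/\ 0 \notin s, uniq s & {in s &, forall a b, a != b -> nonprop a b}].

Lemma reduced_neq0 s a : reduced s -> a \in s -> a != 0.
Proof. by move=> [s0 _ _] as_; apply: contraNneq s0 => <-. Qed.

Lemma reduced_sub s t : {subset t <= s} -> uniq t -> reduced s -> reduced t.
Proof.
move=> ts ut [s0 us sN]; split=> [||a b at_ bt] //; first exact: contra (ts _) s0.
by apply: sN; apply: ts.
Qed.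

Lemma arr_form_neq0 s : 0 \notin s -> arr_form s != 0.
Proof.
move=> s0; rewrite /arr_form prodf_seq_neq0; apply/allP => a as_ /=.
by rewrite lform_eq0; apply: contraNneq s0 => <-.
Qed.

Lemma msize_arr_form s : 0 \notin s -> msize (arr_form s) = (size s).+1.
Proof.
elim: s => [|a s IHs] s0; first by rewrite /arr_form big_nil msize1.
rewrite in_cons eq_sym negb_or in s0; have /andP[a0 {}s0] := s0.
rewrite /arr_form big_cons msizeM ?lform_eq0 ?arr_form_neq0 //.
by rewrite -/(arr_form s) IHs // msize_lform.
Qed.

Lemma arr_form_homog s : arr_form s \is (size s).-homog.
Proof.
elim: s => [|a s IHs]; rewrite /arr_form ?big_nil ?dhomog1 // big_cons.
exact: (dhomogM (lform_homog a) IHs).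
Qed.

Lemma arr_form_divides s f : reduced s ->
  {in s, forall a, divides (lform a) f} -> divides (arr_form s) f.
Proof.
move=> sr sf; rewrite /arr_form -(big_map lform xpredT id).
apply: prod_primes_divides.
- by move=> _ /mapP[a as_ ->]; apply/lform_prime/(reduced_neq0 sr).
- by rewrite map_inj_uniq; [case: sr | exact: lform_inj].
- move=> _ _ /mapP[a as_ ->] /mapP[b bs ->] ab.
  have [_ _ sN] := sr; apply: nonprop_ndivides (reduced_neq0 sr as_) _.
  by apply: sN => //; apply: contra_neq ab => ->.
by move=> _ /mapP[a as_ ->]; apply: sf.
Qed.

Lemma reduced_size_lt s f : reduced s -> f != 0 ->
  {in s, forall a, divides (lform a) f} -> (size s < msize f)%N.
Proof.
move=> sr f0 /(arr_form_divides sr)[g gE]; have [s0 _ _] := sr.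
have g0 : g != 0 by apply: contra_neq f0 => g0; rewrite gE g0 mul0r.
rewrite gE msizeM ?arr_form_neq0 // msize_arr_form // (mpolySpred _ g0).
by rewrite addSn /= leq_addl.
Qed.

Lemma homog_msize_le d f : f \is d.-homog -> (msize f <= d.+1)%N.
Proof.
have [->|f0] := eqVneq f 0; first by rewrite msize0.
move=> fh; have := dhomog_uniq f0 fh (dhomog_msize fh).
by move=> ->; rewrite -mpolySpred.
Qed.

End LinearForms.

(** * Syzygies as derivations *)

Section Syzygies.
Variable F : numFieldType.
Local Notation S := {mpoly F[3]}.
Implicit Types (a b p q : 'rV[F]_3) (f g h : S) (u v : 'rV[S]_3) (s t : seq 'rV[F]_3).
Local Notation euler := (euler F).

Lemma divides_constI (c : F) f g : c != 0 -> divides f (c%:MP * g) -> divides f g.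
Proof.
move=> c0 [e eE]; exists (c^-1%:MP * e); rewrite -mulrA -eE mulrA -mpolyCM.
by rewrite mulVf // mpolyC1 mul1r.
Qed.

Lemma mderiv_homog d f j : f \is d.-homog -> f^`M(j) \is d.-1.-homog.
Proof.
move=> fh; apply/dhomogP=> m; rewrite mcoeff_msupp mcoeff_deriv => fm.
have /(dhomog_mf fh) <- : (m + U_(j))%MM \in msupp f.
  by rewrite mcoeff_msupp; apply: contraNneq fm => ->; rewrite mul0rn.
by rewrite /= mdegD mdeg1 addn1.
Qed.

(** The syzygies of the partial derivatives of [f] are the derivations of [S] that
    kill [f]; for derivations Leibniz's rule is available. *)
Definition der u f := \sum_(j < 3) u 0 j * f^`M(j).

Lemma derM u f g : der u (f * g) = der u f * g + f * der u g.
Proof.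
rewrite /der mulr_suml mulr_sumr -big_split; apply: eq_bigr => j _ /=.
by rewrite mderivM; ring.
Qed.

Lemma derZ g u f : der (g *: u) f = g * der u f.
Proof. by rewrite /der mulr_sumr; apply: eq_bigr => j _; rewrite mxE mulrA. Qed.

Lemma derB u v f : der (u - v) f = der u f - der v f.
Proof.
by rewrite /der -sumrB; apply: eq_bigr => j _; rewrite !mxE mulrBl.
Qed.

Lemma der1 u : der u 1 = 0.
Proof. by rewrite /der big1 // => j _; rewrite -mpolyC1 mderivC mulr0. Qed.

Lemma der_lform u a : der u (lform a) = dotp (const_vec a) u.
Proof. by apply: eq_bigr => j _; rewrite lform_deriv mxE mulrC. Qed.

Lemma derE u f : der u f = dotp u (\row_j f^`M(j)).
Proof. by apply: eq_bigr => j _; rewrite mxE. Qed.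

Lemma der_euler s : der euler (arr_form s) = (size s)%:R * arr_form s.
Proof.
rewrite /arr_form; elim: s => [|a s IHs]; first by rewrite big_nil der1 mul0r.
by rewrite big_cons derM IHs der_lform -/(lform a) /= -natr1; ring.
Qed.

Lemma dotp_homog d e u v : (forall j, u 0 j \is d.-homog) ->
  (forall j, v 0 j \is e.-homog) -> dotp u v \is (d + e).-homog.
Proof. by move=> uh vh; apply: rpred_sum => j _; apply: dhomogM. Qed.

Lemma crossp_homog d e u v : (forall j, u 0 j \is d.-homog) ->
  (forall j, v 0 j \is e.-homog) -> forall j, crossp u v 0 j \is (d + e).-homog.
Proof.
by move=> uh vh; apply: ord3P; rewrite mxE /=; apply: rpredB; apply: dhomogM.
Qed.

Lemma euler_homog j : euler 0 j \is 1.-homog.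
Proof. by rewrite mxE dhomogX /= mdeg1. Qed.

Lemma triple_homog d e u v : (forall j, u 0 j \is d.-homog) ->
  (forall j, v 0 j \is e.-homog) -> triple euler u v \is (d + e).+1.-homog.
Proof.
by move=> uh vh; apply: (dotp_homog (crossp_homog euler_homog uh) vh).
Qed.

Section Arrangement.
Variable s : seq 'rV[F]_3.
Hypothesis s_red : reduced s.
Local Notation f := (arr_form s).

Lemma arr_form_rem a : a \in s -> exists g, f = lform a * g /\ ~ divides (lform a) g.
Proof.
move=> as_; exists (arr_form (rem a s)); split.
  by rewrite /arr_form (perm_big _ (perm_to_rem as_)) big_cons.
have [_ us sN] := s_red; have a0 := reduced_neq0 s_red as_.
rewrite /arr_form -(big_map (@lform F) xpredT id) -[X in divides _ X]mul1r.
move=> /(prime_divides_prod (lform_prime a0) (unitr1 _))[_ /mapP[b bs ->]].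
apply: nonprop_ndivides => //; move: bs; rewrite mem_rem_uniq // inE => /andP[ba bs].
by apply: sN => //; rewrite eq_sym.
Qed.

(** By Leibniz's rule for [f = lform a * g], the form [lform a] divides the product
    of [der u (lform a)] and [g], and it does not divide [g]: the field [u] is
    tangent to each line. *)
Lemma syz_tangent u a : der u f = 0 -> a \in s ->
  divides (lform a) (dotp (const_vec a) u).
Proof.
move=> uf as_; have [g [fE Ng]] := arr_form_rem as_.
have a0 := reduced_neq0 s_red as_; have [_ _ lP] := lform_prime a0.
have : divides (lform a) (der u (lform a) * g).
  by exists (- der u g); move/eqP: uf; rewrite fE derM addr_eq0 => /eqP ->; ring.
by move=> /lP[|/Ng //]; rewrite der_lform.
Qed.

(** Saito's argument: modulo each line the three derivations are tangent to it,
    hence linearly dependent. *)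
Lemma saito u v : der u f = 0 -> der v f = 0 -> divides f (triple euler u v).
Proof.
move=> uf vf; apply: arr_form_divides s_red _ => a as_.
have /rV0Pn[j aj] := reduced_neq0 s_red as_.
apply: (divides_constI aj); have := cramer3 (const_vec a) euler u v j.
rewrite {1}mxE => ->; apply: dividesD; last exact/divides_mulr/syz_tangent.
apply: dividesD; first exact/divides_mulr/divides_refl.
exact/divides_mulr/syz_tangent.
Qed.

Hypothesis s_nnil : (0 < size s)%N.

Lemma der_euler_neq0 : der euler f != 0.
Proof.
have [s0 _ _] := s_red; rewrite der_euler mulf_neq0 ?arr_form_neq0 //.
by rewrite -mpolyC_nat mpolyC_eq0 pnatr_eq0 -lt0n.
Qed.

(** A multiple of [euler] does not kill [f] by Euler's formula. *)
Lemma syz_euler_crossp_eq0 u : der u f = 0 -> crossp euler u = 0 -> u = 0.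
Proof.
move=> uf /crossp_eq0P xu; apply/rowP=> i; rewrite mxE; apply/eqP.
have : u 0 i * der euler f = 0.
  transitivity (euler 0 i * der u f); last by rewrite uf mulr0.
  by rewrite /der !mulr_sumr; apply: eq_bigr => j _; rewrite !mulrA xu [u 0 i * _]mulrC xu mulrC.
by move/eqP; rewrite mulf_eq0 (negPf der_euler_neq0) orbF.
Qed.

(** [u] and [v] kill [f], so their cross product is a multiple of the gradient,
    which [euler] does not kill. *)
Lemma syz_dependent u v : der u f = 0 -> der v f = 0 -> triple euler u v = 0 ->
  crossp u v = 0.
Proof.
rewrite triple_rot /triple !derE => uf vf uv0.
set gr := \row_j _ in uf vf.
have /crossp_eq0P par : crossp (crossp u v) gr = 0.
  by apply/rowP=> i; rewrite double_crossp uf vf !mulr0 subr0 mxE.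
apply/rowP=> i; rewrite [RHS]mxE; apply/eqP.
have : crossp u v 0 i * der euler f = 0.
  transitivity (gr 0 i * dotp (crossp u v) euler); last by rewrite uv0 mulr0.
  rewrite /der /dotp !mulr_sumr; apply: eq_bigr => j _.
  by have := par i j; rewrite ![gr _ _]mxE => e; rewrite mulrCA e; ring.
by move/eqP; rewrite mulf_eq0 (negPf der_euler_neq0) orbF.
Qed.

End Arrangement.

Section PointSyzygy.
Variables (s : seq 'rV[F]_3).
Local Notation f := (arr_form s).

Definition lines_off p := [seq a <- s | dotp a p != 0].

(** With [f = g * h], where [g] collects the lines through [p] and [h] the other
    ones, the constant field [p] kills [g] and [euler] multiplies [f] by its
    degree; this combination of the two kills [f]. *)
Definition point_syzygy p : 'rV[S]_3 :=
  der (const_vec p) (arr_form (lines_off p)) *: euler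
  - ((size s)%:R * arr_form (lines_off p)) *: const_vec p.

Lemma der_const_lform p a : der (const_vec p) (lform a) = (dotp a p)%:MP.
Proof. by rewrite der_lform map_dotp. Qed.

Lemma point_syzygy_der p : der (point_syzygy p) f = 0.
Proof.
have [g fE gp] : exists2 g, f = g * arr_form (lines_off p) & der (const_vec p) g = 0.
  exists (arr_form [seq a <- s | dotp a p == 0]).
    by rewrite /arr_form [LHS](bigID (fun a => dotp a p == 0)) /= !big_filter.
  have : {in [seq a <- s | dotp a p == 0], forall a, dotp a p = 0}.
    by move=> a; rewrite mem_filter => /andP[/eqP].
  elim: [seq a <- s | _] => [|a t IHt] tp; first by rewrite /arr_form big_nil der1.
  rewrite /arr_form big_cons derM der_const_lform tp ?mem_head // mpolyC0 mul0r add0r.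
  by rewrite IHt ?mulr0 // => b bt; apply: tp; rewrite in_cons bt orbT.
by rewrite derB !derZ der_euler {2}fE derM gp {1}fE; ring.
Qed.

Lemma point_syzygy_homog p j : point_syzygy p 0 j \is (size (lines_off p)).-homog.
Proof.
rewrite !mxE rpredB //; last first.
  rewrite -mpolyC_nat mulrAC -mpolyCM mul_mpolyC rpredZ //.
  exact: arr_form_homog.
have [off0|off0] := posnP (size (lines_off p)).
  move/size0nil: off0 => ->; rewrite /arr_form big_nil der1 mul0r.
  exact: dhomog0.
have -> : size (lines_off p) = ((size (lines_off p)).-1 + 1)%N by rewrite addn1 prednK.
apply: dhomogM; last first.
  by rewrite dhomogX /= mdeg1.
apply: rpred_sum => i _; rewrite mxE mul_mpolyC rpredZ //.
exact/mderiv_homog/arr_form_homog.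
Qed.

Lemma point_syzygy_independent p q : reduced s -> (0 < size s)%N -> nonprop p q ->
  triple euler (point_syzygy p) (point_syzygy q) != 0.
Proof.
move=> [s0 us sN] s_nnil pq.
have -> : triple euler (point_syzygy p) (point_syzygy q) =
    ((size s)%:R * arr_form (lines_off p)) * ((size s)%:R * arr_form (lines_off q))
    * lform (crossp p q).
  transitivity ((size s)%:R * arr_form (lines_off p) * ((size s)%:R * arr_form (lines_off q))
      * triple euler (const_vec p) (const_vec q)).
    exact: triple_combination.
  by rewrite triple_rot /triple map_crossp.
have off_neq0 r : arr_form (lines_off r) != 0.
  by apply: arr_form_neq0; apply: contra s0; rewrite mem_filter => /andP[].
have n0 : (size s)%:R != 0 :> S by rewrite -mpolyC_nat mpolyC_eq0 pnatr_eq0 -lt0n.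
by rewrite !mulf_neq0 ?lform_eq0.
Qed.

End PointSyzygy.
End Syzygies.

(** * Syzygies of low degree *)

Section LowDegree.
Variable F : numFieldType.
Local Notation S := {mpoly F[3]}.
Implicit Types (a b p q : 'rV[F]_3) (f g h : S) (u v w : 'rV[S]_3) (s t : seq 'rV[F]_3).
Local Notation euler := (euler F).

(** The minors of [u] and [v] are, up to sign, the coordinates of their cross
    product. *)
Lemma crossp_minor_divides g u v : (forall i, divides g (crossp u v 0 i)) ->
  forall i j, divides g (u 0 i * v 0 j - u 0 j * v 0 i).
Proof.
move=> gc.
have min : forall i j, exists k, u 0 i * v 0 j - u 0 j * v 0 i = crossp u v 0 k
    \/ u 0 i * v 0 j - u 0 j * v 0 i = - crossp u v 0 k \/ i = j.
  apply: ord3P; apply: ord3P; try (by exists o0; right; right);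
  by [exists o0; rewrite !mxE /=; (left; ring) || (right; left; ring)
     |exists o1; rewrite !mxE /=; (left; ring) || (right; left; ring)
     |exists o2; rewrite !mxE /=; (left; ring) || (right; left; ring)].
move=> i j; have [k [->|[->|->]]] := min i j; first exact: gc.
  by rewrite -[- _]add0r; apply: dividesB; [apply: divides0 | apply: gc].
by rewrite subrr; apply: divides0.
Qed.

(** Along a line to which [u] is tangent, [crossp euler u] is proportional to the
    covector of the line. *)
Lemma tangent_minor a u i j : divides (lform a) (dotp (const_vec a) u) ->
  divides (lform a)
    (crossp euler u 0 i * (a 0 j)%:MP - crossp euler u 0 j * (a 0 i)%:MP).
Proof.
move=> au; have := @crossp_minor_divides (lform a) (crossp euler u) (const_vec a).
rewrite /const_vec => H; have {H} := H _ i j; rewrite !mxE; apply => k.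
rewrite double_crossp dotpC; apply: dividesB; last by rewrite dotpC; apply: divides_mull.
exact/divides_mull/divides_refl.
Qed.

Lemma tangent_crossp a u k : a 0 k != 0 -> divides (lform a) (dotp (const_vec a) u) ->
  divides (lform a) (crossp euler u 0 k) ->
  forall j, divides (lform a) (crossp euler u 0 j).
Proof.
move=> ak au ck j; apply: (divides_constI ak).
have := tangent_minor j k au; rewrite mulrC => jk.
rewrite -[X in divides _ X](subrK (crossp euler u 0 k * (a 0 j)%:MP)).
by apply: dividesD => //; apply: divides_mulr.
Qed.

(** Two lines cross at a point where [u], being tangent to both, is proportional
    to [euler]. *)
Lemma tangent_two_lines a b u k : a 0 k != 0 -> nonprop a b ->
  divides (lform a) (dotp (const_vec a) u) -> divides (lform b) (dotp (const_vec b) u) ->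
  divides (restrict a k (lform b)) (restrict a k (crossp euler u 0 k)).
Proof.
move=> ak ab au bu.
have [i bi] : exists i, a 0 k * b 0 i - b 0 k * a 0 i != 0.
  apply/existsP; apply: contraNT ab; rewrite negb_exists => /forallP ab.
  apply/eqP/crossp_eq0P; have e i : b 0 i = (b 0 k / a 0 k) * a 0 i.
    have := ab i; rewrite negbK subr_eq0 => /eqP e.
    by apply: (mulfI ak); rewrite e; field.
  by move=> i j; rewrite (e i) (e j); ring.
have := tangent_minor i k au; have := tangent_minor i k bu.
move: (crossp euler u 0 i) (crossp euler u 0 k) => ci ck [gb eb] [ga ea].
apply: (divides_constI bi); exists ((a 0 k)%:MP * - restrict a k gb).
rewrite -[_%:MP](restrictC a k) -restrictM.
have -> : (a 0 k * b 0 i - b 0 k * a 0 i)%:MP * ck =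
    (b 0 k)%:MP * ga * lform a + (- (a 0 k))%:MP * gb * lform b.
  rewrite -!mulrA -ea -eb !(mpolyCB, mpolyCM, mpolyCN); ring.
by rewrite restrictD !restrictM restrict_self // mulr0 add0r !restrictC mpolyCN mulrN !mulNr.
Qed.

(** A coordinate of [crossp euler u], restricted to the line [a], is a form of
    degree [d.+1] on a projective line which vanishes at its points on the lines
    of [t].  There are more of these points than its degree allows. *)
Lemma syz_along_line s t a u d : reduced s -> a \in s -> {subset t <= s} ->
  der u (arr_form s) = 0 -> (forall j, u 0 j \is d.-homog) ->
  uniq t -> {in t, forall b, nonprop a b} ->
  {in t &, forall b c, b != c -> triple a b c != 0} ->
  (d.+1 < size t)%N -> forall j, divides (lform a) (crossp euler u 0 j).
Proof.
move=> s_red as_ ts uf uh ut ta tN dt.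
have a0 := reduced_neq0 s_red as_; have /rV0Pn[k ak] := a0.
have tang b : b \in s -> divides (lform b) (dotp (const_vec b) u) by apply: syz_tangent.
apply: (tangent_crossp ak (tang _ as_)); apply/(restrict_eq0 ak).
pose r b := b - (b 0 k / a 0 k) *: a.
have rN : {in t &, forall b c, b != c -> nonprop (r b) (r c)}.
  move=> b c bt ct /(tN b c bt ct); apply: contra_neq => bc.
  have -> : triple a b c = dotp (crossp (r b) (r c)) a.
    by rewrite /triple !dotpE !mxE /=; ring.
  by rewrite bc dotpE !mxE; ring.
have t_red : reduced (map r t).
  split.
  - apply/mapP => -[b bt r0]; have := ta b bt; rewrite /nonprop.
    have -> : b = (b 0 k / a 0 k) *: a by apply/eqP; rewrite -subr_eq0 -/(r b) -r0.
    by rewrite crosspZr crosspp scaler0 eqxx.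
  - rewrite map_inj_in_uniq // => b c bt ct rbc; apply/eqP/negPn/negP => bc.
    by have := rN _ _ bt ct bc; rewrite /nonprop rbc crosspp eqxx.
  move=> _ _ /mapP[b bt ->] /mapP[c ct ->] rbc.
  by apply: rN => //; apply: contra_neq rbc => ->.
apply/eqP/negPn/negP => ck; have := reduced_size_lt t_red ck.
rewrite size_map => H; have {}H : (size t < msize (restrict a k (crossp euler u 0%R k)))%N.
  apply: H => _ /mapP[b bt ->]; rewrite -restrict_lform //.
  by apply: tangent_two_lines; rewrite ?ta //; apply: tang => //; apply: ts.
have := homog_msize_le (restrict_homog a k (crossp_homog (@euler_homog F) uh k)).
by rewrite leqNgt (leq_trans _ H).
Qed.

(** Where both [crossp euler u] and [crossp euler v] vanish, [triple euler u v]
    vanishes doubly, and [f] accounts for only one of the two factors. *)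
Lemma double_line s a u v h : reduced s -> a \in s ->
  triple euler u v = h * arr_form s ->
  (forall j, divides (lform a) (crossp euler u 0 j)) ->
  (forall j, divides (lform a) (crossp euler v 0 j)) -> divides (lform a) h.
Proof.
move=> s_red as_ hE ua va; have a0 := reduced_neq0 s_red as_.
have [l0 _ lP] := lform_prime a0; have /rV0Pn[k ak] := a0.
have [g [fE Ng]] := arr_form_rem s_red as_.
have [i ik] : exists i : 'I_3, i != k.
  by move: k {ak}; apply: ord3P; [exists o1 | exists o0 | exists o0].
have dbl : divides (lform a * lform a) (triple euler u v * euler 0 i).
  rewrite -crossp_crossp.
  have two j j' : divides (lform a * lform a) (crossp euler u 0 j * crossp euler v 0 j').
    by have [x ->] := ua j; have [y ->] := va j'; exists (x * y); ring.
  by move: i {ik}; apply: ord3P; rewrite [X in divides _ X]mxE /=; apply: dividesB.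
case: dbl => e eE; have : divides (lform a) (h * (g * euler 0 i)).
  exists e; apply: (mulfI l0); rewrite hE fE in eE.
  by rewrite [RHS]mulrC -mulrA -eE; ring.
move=> /lP[//|/lP[//|]].
have -> : euler 0 i = lform (delta_mx 0 i).
  rewrite lformE (bigD1 i) //= !mxE !eqxx scale1r big1 ?addr0 // => j ji.
  by rewrite mxE (negPf ji) andbF scale0r.
move=> /(lform_divides a0)[c cE].
have := congr1 (fun w : 'rV[F]_3 => w 0 k) cE.
rewrite !mxE eqxx eq_sym (negPf ik) => /eqP; rewrite eq_sym mulf_eq0 (negPf ak) orbF.
move=> /eqP c0; have := congr1 (fun w : 'rV[F]_3 => w 0 i) cE.
by rewrite c0 scale0r !mxE !eqxx => /eqP; rewrite oner_eq0.
Qed.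

Lemma saito_degree s t u v d e : reduced s -> reduced t -> {subset t <= s} ->
  der u (arr_form s) = 0 -> der v (arr_form s) = 0 ->
  (forall j, u 0 j \is d.-homog) -> (forall j, v 0 j \is e.-homog) ->
  {in t, forall a j, divides (lform a) (crossp euler u 0 j)} ->
  {in t, forall a j, divides (lform a) (crossp euler v 0 j)} ->
  triple euler u v != 0 -> (size s + size t <= (d + e).+1)%N.
Proof.
move=> s_red t_red ts uf vf uh vh ut vt uv0; have [h hE] := saito s_red uf vf.
have th : divides (arr_form t) h.
  apply: arr_form_divides t_red _ => a at_.
  by apply: double_line s_red (ts _ at_) hE _ _; [apply: ut | apply: vt].
have [[s0 _ _] [t0 _ _]] := (s_red, t_red); have [g gE] := th.
have := homog_msize_le (triple_homog uh vh).
have g0 : g != 0 by apply: contra_neq uv0 => g0; rewrite hE gE g0 !mul0r.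
rewrite hE gE !msizeM ?mulf_neq0 ?arr_form_neq0 // !msize_arr_form //.
have : (0 < msize g)%N by rewrite lt0n msize_poly_eq0.
by move: (msize g) (size s) (size t) => x y z; lia.
Qed.

(** The intersection points on the lines of [s2] are double.  Hence a line of [s2]
    carries [(size s).-1] points, and a line of [s1] carries [size s2] such points
    and at least one more, on another line of [s1].  Along all these lines,
    syzygies of low degree are proportional to [euler]. *)
Section PencilAndGeneric.
Variables s1 s2 : seq 'rV[F]_3.
Local Notation s := (s1 ++ s2).
Local Notation f := (arr_form s).
Hypothesis s_red : reduced s.
Hypothesis s1_ge2 : (1 < size s1)%N.
Hypothesis generic : {in s2 & s & s, forall b c c',
  b != c -> b != c' -> c != c' -> triple b c c' != 0}.

Lemma generic_line_divides u d : der u f = 0 -> (forall j, u 0 j \is d.-homog) ->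
  (d.+2 < size s)%N -> {in s2, forall b j, divides (lform b) (crossp euler u 0 j)}.
Proof.
move=> uf uh ds b bs2; have bs : b \in s by rewrite mem_cat bs2 orbT.
have [_ us sN] := s_red.
have rs c : c \in rem b s -> c \in s /\ b != c.
  by rewrite mem_rem_uniq // inE eq_sym => /andP[].
apply: (syz_along_line (t := rem b s) s_red bs _ uf uh).
- by move=> c /rs[].
- exact: rem_uniq.
- by move=> c /rs[cs bc]; apply: sN.
- by move=> c c' /rs[cs bc] /rs[cs' bc']; apply: generic.
by rewrite size_rem // -ltnS; case: (size s) ds.
Qed.

Lemma pencil_line_divides u d : der u f = 0 -> (forall j, u 0 j \is d.-homog) ->
  (d < size s2)%N -> {in s1, forall a j, divides (lform a) (crossp euler u 0 j)}.
Proof.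
move=> uf uh ds a as1; have as_ : a \in s by rewrite mem_cat as1.
have [_ us sN] := s_red; move: (us); rewrite cat_uniq => /and3P[us1 /hasPn s12 us2].
have [a' a's1 aa'] : exists2 a', a' \in s1 & a != a'.
  have : (0 < size (rem a s1))%N by rewrite size_rem // -ltnS (ltn_predK s1_ge2).
  case E : (rem a s1) => [|a' r] // _; exists a'.
    by apply: (mem_rem (x := a)); rewrite E mem_head.
  have : a' \in rem a s1 by rewrite E mem_head.
  by rewrite mem_rem_uniq // inE eq_sym => /andP[].
have a's : a' \in s by rewrite mem_cat a's1.
have ts c : c \in a' :: s2 -> c \in s /\ a != c.
  rewrite in_cons => /predU1P[-> //|cs2]; rewrite mem_cat cs2 orbT; split=> //.
  by apply: contraTneq as1 => ->; apply: s12.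
apply: (syz_along_line (t := a' :: s2) s_red as_ _ uf uh).
- by move=> c /ts[].
- by rewrite /= us2 andbT; apply: contraL a's1; apply: s12.
- by move=> c /ts[cs ac]; apply: sN.
- move=> c c' ct ct' cc'; have [[cs ac] [cs' ac']] := (ts c ct, ts c' ct').
  move: ct; rewrite in_cons => /predU1P[cE|cs2]; last first.
    by rewrite triple_rot tripleC oppr_eq0 (generic cs2 as_ cs') // 1?eq_sym.
  move: ct'; rewrite in_cons => /predU1P[c'E|cs2]; first by rewrite cE c'E eqxx in cc'.
  by rewrite -triple_rot (generic cs2 as_ cs) // eq_sym.
by rewrite /= ltnS.
Qed.

(** A nonzero syzygy has degree at least [size s2], as it would otherwise be
    proportional to [euler] along all lines.  This is enough if one of the degrees
    is at least [size s - 2]; if neither is, the lines of [s2] count twice in the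
    determinant. *)
Lemma pencil_generic_degree u v d e :
  der u f = 0 -> der v f = 0 ->
  (forall j, u 0 j \is d.-homog) -> (forall j, v 0 j \is e.-homog) ->
  triple euler u v != 0 -> (size s + size s2 <= (d + e).+2)%N.
Proof.
have s_nnil : (0 < size s)%N by rewrite size_cat ltn_addr // ltnW.
have low w k : der w f = 0 -> (forall j, w 0 j \is k.-homog) -> w != 0 ->
    (size s2 <= k)%N.
  move=> wf wh; apply: contraNT; rewrite -ltnNge => ks2.
  apply/eqP/(syz_euler_crossp_eq0 s_red s_nnil wf)/rowP => j; rewrite [RHS]mxE.
  apply/eqP/negPn/negP => w0; have := homog_msize_le (crossp_homog (@euler_homog F) wh j).
  rewrite leqNgt (leq_trans _ (reduced_size_lt s_red w0 _)) //.
    by rewrite size_cat; lia.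
  move=> a; rewrite mem_cat => /orP[|] as_.
    exact: (pencil_line_divides wf wh ks2 as_ j).
  have ks : (k.+2 < size s)%N by rewrite size_cat; lia.
  exact: (generic_line_divides wf wh ks as_ j).
move=> uf vf uh vh uv0.
have u0 : u != 0 by apply: contra_neq uv0 => ->; apply: triple0m.
have v0 : v != 0 by apply: contra_neq uv0 => ->; apply: triplem0.
have := low _ _ uf uh u0; have := low _ _ vf vh v0 => s2e s2d.
have [ds|ds] := ltnP d.+2 (size s); last by lia.
have [es|es] := ltnP e.+2 (size s); last by lia.
apply: leq_trans (leqnSn _); apply: (saito_degree s_red _ _ uf vf uh vh _ _ uv0).
- apply: reduced_sub s_red; first by move=> b bs; rewrite mem_cat bs orbT.
  by have [_] := s_red; rewrite cat_uniq => /and3P[].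
- by move=> b bs; rewrite mem_cat bs orbT.
- exact: (generic_line_divides uf uh ds).
exact: (generic_line_divides vf vh es).
Qed.

End PencilAndGeneric.
End LowDegree.

(** * Minimal generators *)

Section Grading.
Variable F : numFieldType.
Local Notation S := {mpoly F[3]}.
Implicit Types (f g : S) (u v w : 'rV[S]_3).

(** Multiplication by a form of degree [e] shifts the grading by [e]. *)
Lemma pihomogM_homog d e f g : g \is e.-homog ->
  pihomog mdeg d (f * g) = if (e <= d)%N then pihomog mdeg (d - e) f * g else 0.
Proof.
move=> gh; elim/mpolyind: f => [|c m f _ _ IHf].
  by rewrite mul0r !linear0 mul0r; case: ifP.
rewrite mulrDl -scalerAl !pihomogD IHf !linearZ /= pihomogX.
have mh : 'X_[m] * g \is (mdeg m + e).-homog by rewrite dhomogM // dhomogX.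
have [mE|mN] := eqVneq (mdeg m + e)%N d.
  rewrite -mE leq_addl addnK eqxx pihomog_dE // mulrDl scalerAl //.
rewrite (pihomog_ne0 mN mh) scaler0 add0r; case: leqP => // ed.
have -> : (mdeg m == (d - e)%N) = false.
  by apply: contraNF mN => /eqP ->; rewrite subnK.
by rewrite scaler0 add0r.
Qed.

Lemma scale_constK (c : F) f w : c != 0 ->
  f *: w = (f * (c^-1)%:MP) *: (c%:MP *: w).
Proof.
by move=> c0; rewrite scalerA -mulrA -mpolyCM mulVf // mpolyC1 mulr1.
Qed.

Definition homog_part k u : 'rV[S]_3 := map_mx (pihomog mdeg k) u.

Lemma homog_part_homog k u j : homog_part k u 0 j \is k.-homog.
Proof. by rewrite mxE; apply: pihomogP. Qed.

Lemma homog_part_id k u : (forall j, u 0 j \is k.-homog) -> homog_part k u = u.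
Proof. by move=> uh; apply/rowP=> j; rewrite mxE pihomog_dE. Qed.

Lemma homog_part_neq k l u : (forall j, u 0 j \is l.-homog) -> l != k ->
  homog_part k u = 0.
Proof. by move=> uh lk; apply/rowP=> j; rewrite !mxE (pihomog_ne0 lk). Qed.

Lemma homog_part_sum K u : (forall j, (msize (u 0%R j) <= K)%N) ->
  u = \sum_(k < K) homog_part k u.
Proof.
move=> uK; apply/rowP=> j; rewrite summxE [LHS](pihomog_partitionE (uK j)).
by apply: eq_bigr => k _; rewrite mxE.
Qed.

(** Conditions on the parts of low degree of the elements of a module need only
    be checked on its generators. *)
Lemma homog_part_submodule (Q : 'rV[S]_3 -> Prop) K : submodule Q ->
  submodule (fun w => forall k, (k < K)%N -> Q (homog_part k w)).
Proof.
move=> Qsub; split=> [k _|f u v Qu Qv k kK].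
  by rewrite /homog_part map_mx0; apply: submodule0.
have homog_partD w w' : homog_part k (w + w') = homog_part k w + homog_part k w'.
  by apply/rowP=> j; rewrite !mxE linearD.
have homog_partZ c w : homog_part k (c%:MP *: w) = c%:MP *: homog_part k w.
  by apply/rowP=> j; rewrite !mxE !mul_mpolyC linearZ.
rewrite homog_partD; apply: (submoduleD Qsub) (Qv k kK).
elim/mpolyind: f => [|c m f _ _ IHf].
  by rewrite scale0r /homog_part map_mx0; apply: submodule0.
rewrite scalerDl homog_partD; apply: (submoduleD Qsub) IHf.
rewrite -mul_mpolyC -scalerA homog_partZ; apply: (submoduleZ Qsub).
have -> : homog_part k ('X_[m] *: u) =
    if (mdeg m <= k)%N then 'X_[m] *: homog_part (k - mdeg m) u else 0.
  apply/rowP=> j; rewrite !mxE [_ * u 0 j]mulrC (@pihomogM_homog _ (mdeg m)).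
    by case: ifP; rewrite !mxE // mulrC.
  by rewrite dhomogX.
case: ifP => _; last exact: submodule0.
by apply: (submoduleZ Qsub); apply: Qu; rewrite (leq_ltn_trans (leq_subr _ _)).
Qed.

Lemma der_submodule f : submodule (fun u => der u f = 0).
Proof.
split=> [|g u v uf vf]; first by rewrite /der big1 // => j _; rewrite mxE mul0r.
rewrite /der; under eq_bigr => j _ do rewrite !mxE mulrDl -mulrA.
by rewrite big_split /= -mulr_sumr -!/(der _ _) uf vf mulr0 addr0.
Qed.

Lemma der_homog_part d f k u : f \is d.-homog -> der u f = 0 ->
  der (homog_part k u) f = 0.
Proof.
move=> fh uf; transitivity (pihomog mdeg (k + d.-1) (der u f)); last first.
  by rewrite uf linear0.
rewrite /der linear_sum; apply: eq_bigr => j _; rewrite mxE /=.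
by rewrite (pihomogM_homog _ _ (mderiv_homog j fh)) leq_addl addnK.
Qed.

End Grading.

Lemma lspanP (T : nzRingType) (V : lmodType T) (g : seq V) x :
  lspan g x <-> exists c : 'I_(size g) -> T, x = \sum_(i < size g) c i *: g`_i.
Proof.
split=> [gx|[c ->]]; last first.
  apply: (submodule_sum (lspan_submodule g)) => i _.
  by apply: (submoduleZ (lspan_submodule g)); apply: mem_lspan; rewrite mem_nth.
apply: (gx (fun x => exists c : 'I_(size g) -> T, x = \sum_(i < size g) c i *: g`_i)).
  split.
    by exists (fun=> 0); rewrite big1 // => i _; rewrite scale0r.
  move=> a _ _ [c ->] [e ->]; exists (fun i => a * c i + e i).
  rewrite scaler_sumr -big_split; apply: eq_bigr => i _ /=.
  by rewrite scalerDl scalerA.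
move=> y yg; have yi : (index y g < size g)%N by rewrite index_mem.
exists (fun i => (i == Ordinal yi)%:R); rewrite (bigD1 (Ordinal yi)) //= eqxx scale1r.
by rewrite nth_index // big1 ?addr0 // => i /negPf ->; rewrite scale0r.
Qed.

Lemma lspan_nil (T : nzRingType) (V : lmodType T) (x : V) : lspan [::] x <-> x = 0.
Proof.
by rewrite lspanP; split=> [[c ->]|->]; [rewrite big_ord0 | exists (fun=> 0); rewrite big_ord0].
Qed.

Lemma lspan1P (T : nzRingType) (V : lmodType T) (x y : V) :
  lspan [:: x] y <-> exists c, y = c *: x.
Proof.
rewrite lspanP; split=> [[c ->]|[c ->]].
  by exists (c ord0); rewrite big_ord_recl big_ord0 addr0.
by exists (fun=> c); rewrite big_ord_recl big_ord0 addr0.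
Qed.

Section Generators.
Variable R : realType.
Local Notation S := {mpoly R[i][3]}.
Implicit Types (M : set 'rV[S]_3) (g : seq 'rV[S]_3).

Lemma generatesP M g :
  generates M g <-> {in g, forall r, M r} /\ forall r, M r -> lspan g r.
Proof.
by split=> -[gM gP]; split=> // r Mr; apply/lspanP; apply: gP.
Qed.

(** Otherwise one of the first two generators could be left out. *)
Lemma minimal_generators_cons x y g M : minimal_generators M [:: x, y & g] ->
  x != 0 /\ ~ lspan [:: x] y.
Proof.
move=> [/generatesP[gM gP] gmin]; split.
  apply/eqP => x0; have /gmin : subseq (y :: g) [:: x, y & g] by apply: subseq_cons.
  have gen : generates M (y :: g).
    apply/generatesP; split=> [r rg|r /gP].
      by apply: gM; rewrite in_cons rg orbT.
    apply: lspan_trans => z; rewrite in_cons => /predU1P[->|]; last exact: mem_lspan.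
    by rewrite x0; apply: submodule0; apply: lspan_submodule.
  by move=> /(_ gen) /(congr1 size) /eqP; rewrite /= ltn_eqF.
move=> xy; have /gmin : subseq (x :: g) [:: x, y & g].
  exact: (cat_subseq (subseq_refl [:: x]) (subseq_cons g y)).
have gen : generates M (x :: g).
  apply/generatesP; split=> [r rg|r /gP].
    by apply: gM; move: rg; rewrite !in_cons => /orP[->|->]; rewrite ?orbT.
  apply: lspan_trans => z; rewrite !in_cons => /or3P[/eqP->|/eqP->|zg].
  - by apply: mem_lspan; rewrite mem_head.
  - by apply: lspan_sub xy => t; rewrite inE in_cons => ->.
  by apply: mem_lspan; rewrite in_cons zg orbT.
by move=> /(_ gen) /(congr1 size) /eqP; rewrite /= ltn_eqF.
Qed.

Section Arrangement.
Variable s : seq 'rV[R[i]]_3.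
Hypothesis s_red : reduced s.
Hypothesis s_nnil : (0 < size s)%N.
Local Notation f := (arr_form s).
Local Notation M := (jacobian_syzygy f).

Lemma syzE u : M u <-> der u f = 0. Proof. by []. Qed.

(** Among the finite systems of homogeneous generators, ordered by degree, one
    with the least number of elements is minimal. *)
Lemma generator_degrees_exist : exists ds, generator_degrees M ds.
Proof.
have [G GM GP] := fin_gen_row (@noetherian_mpoly R[i] 3) (der_submodule f).
pose good (H : seq (nat * 'rV[S]_3)) :=
  (forall x, x \in H -> homog_vec x.1 x.2) /\ generates M (map snd H).
have exH : exists n, `[< exists2 H, good H & size H = n >].
  pose K := (\max_(u <- G) \max_(j < 3) msize (u 0%R j))%N.
  pose H := [seq (k, homog_part k u) | u <- G, k <- iota 0 K].
  exists (size H); apply/asboolP; exists H => //; split.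
    by move=> _ /allpairsP[[u k] [_ _ ->]] j; apply: homog_part_homog.
  apply/generatesP; split.
    move=> _ /mapP[_ /allpairsP[[u k] [uG _ ->]] ->]; rewrite syzE.
    by apply: der_homog_part (arr_form_homog s) _; apply: GM.
  move=> r /GP; apply: lspan_trans => u uG.
  have uK j : (msize (u 0%R j) <= K)%N.
    have uK := leq_bigmax_seq (F := fun u : 'rV[S]_3 => \max_(j < 3) msize (u 0%R j)) u uG isT.
    by apply: leq_trans uK; apply: (@leq_bigmax _ (fun j => msize (u 0%R j)) j).
  rewrite (homog_part_sum uK); apply: (submodule_sum (lspan_submodule _)) => k _.
  apply: mem_lspan; apply/mapP; exists (nat_of_ord k, homog_part k u) => //.
  by apply/allpairsP; exists (u, nat_of_ord k); rewrite mem_iota ltn_ord.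
case: (ex_minnP exH) => n /asboolP[H0 H0P <-] Hmin.
pose le (x y : nat * 'rV[S]_3) := (x.1 <= y.1)%N.
pose H := sort le H0.
have Hperm : perm_eq H H0 by apply/permPl/perm_sort.
have goodH : good H.
  case: H0P => Hh /generatesP[HM HP]; split.
    by move=> x; rewrite (perm_mem Hperm); apply: Hh.
  have Hm := perm_mem (perm_map snd Hperm); apply/generatesP; split.
    by move=> r; rewrite Hm; apply: HM.
  by move=> r /HP; apply: lspan_sub => z; rewrite Hm.
case: goodH => Hh Hgen; exists (map fst H), (map snd H); split.
- split=> // g' /subseqP[m mE g'E] g'gen; apply/eqP.
  have g'sub : subseq g' (map snd H) by rewrite g'E mask_subseq.
  rewrite -(size_subseq_leqif g'sub) eqn_leq size_subseq //=.
  rewrite size_map (perm_size Hperm); apply: Hmin; apply/asboolP.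
  exists (mask m H); last by rewrite g'E -map_mask size_map.
  split; last by rewrite map_mask -g'E.
  by move=> x /mem_mask; apply: Hh.
- by rewrite !size_map.
- move=> i; rewrite size_map => iH; rewrite (nth_map (0%N, 0)) // (nth_map (0%N, 0)) //.
  by apply: Hh; apply: mem_nth.
rewrite sorted_map; apply: sort_sorted => x y; exact: leq_total.
Qed.

Section TwoGenerators.
Variables (d1 d2 : nat) (ds : seq nat) (x y : 'rV[S]_3) (g : seq 'rV[S]_3).
Hypothesis gmin : minimal_generators M [:: x, y & g].
Hypothesis xh : homog_vec d1 x.
Hypothesis yh : homog_vec d2 y.
Hypothesis gh : forall r, r \in g -> exists2 d, (d2 <= d)%N & homog_vec d r.
Hypothesis d12 : (d1 <= d2)%N.

Lemma syz_msize w : M w -> w != 0 -> exists j, (d1 < msize (w 0%R j))%N.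
Proof.
move=> Mw w0; apply/existsP; apply: contraNT w0; rewrite negb_exists => /forallP wd.
have [/generatesP[_ gP] _] := gmin.
have Z : forall k, (k < d1)%N -> homog_part k w = 0.
  apply: (gP w Mw (fun w => forall k, (k < d1)%N -> homog_part k w = 0)) => [|r].
    apply: (homog_part_submodule (Q := fun w => w = 0)); split=> // e u v -> ->.
    by rewrite scaler0 addr0.
  move=> rg; have [d dd rh] : exists2 d, (d1 <= d)%N & homog_vec d r.
    move: rg; rewrite !in_cons => /or3P[/eqP->|/eqP->|/gh[d dd rh]]; first by exists d1.
      by exists d2.
    by exists d; rewrite // (leq_trans d12).
  move=> k kd; apply: (homog_part_neq rh).
  by rewrite gtn_eqF // (leq_trans kd).
apply/eqP; rewrite (homog_part_sum (K := d1) (u := w)); last first.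
  by move=> j; have := wd j; rewrite -leqNgt.
by rewrite big1 // => k _; apply: Z.
Qed.

Lemma syz_degree_ge w d : M w -> w != 0 -> homog_vec d w -> (d1 <= d)%N.
Proof.
move=> Mw w0 wh; have [j dj] := syz_msize Mw w0.
by rewrite -ltnS (leq_trans dj) // homog_msize_le.
Qed.

Lemma syz_low w d : M w -> homog_vec d w -> (d < d2)%N -> lspan [:: x] w.
Proof.
move=> Mw wh dd2; have [/generatesP[_ gP] _] := gmin.
rewrite -(homog_part_id wh).
apply: (gP w Mw (fun w => forall k, (k < d2)%N -> lspan [:: x] (homog_part k w))) dd2.
  exact/homog_part_submodule/lspan_submodule.
move=> r.
have sub0 := submodule0 (lspan_submodule [:: x]).
have big z e : (d2 <= e)%N -> homog_vec e z ->
    forall k, (k < d2)%N -> lspan [:: x] (homog_part k z).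
  by move=> de zh k kd; rewrite (homog_part_neq zh) // gtn_eqF // (leq_trans kd).
rewrite !in_cons => /or3P[/eqP->|/eqP->|/gh[e dd rh]].
- move=> k _; have [<-|d1k] := eqVneq d1 k.
    by rewrite homog_part_id //; apply: mem_lspan; rewrite mem_head.
  by rewrite (homog_part_neq xh).
- exact: big yh.
exact: big rh.
Qed.

(** If [x] and [y] were dependent, then [x = a' w] and [y = b' w] for a syzygy [w],
    by unique factorization; as no syzygy has lower degree than [x], [a'] would be
    constant and [y] a multiple of [x]. *)
Lemma first_two_independent : triple (euler _) x y != 0.
Proof.
have [x0 xNy] := minimal_generators_cons gmin.
have [/generatesP[gM _] _] := gmin.
have Mx : M x by apply: gM; rewrite mem_head.
have My : M y by apply: gM; rewrite !in_cons eqxx orbT.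
apply/eqP => xy0; have /crossp_eq0P xy := syz_dependent s_red s_nnil Mx My xy0.
have /rV0Pn[i xi] := x0.
have [c [a [b [xiE yiE ab]]]] := factorial_gcd (y 0 i) (@factorial_mpoly _ 3) xi.
have c0 : c != 0 by apply: contra_neq xi => c0; rewrite xiE c0 mul0r.
have a0 : a != 0 by apply: contra_neq xi => a0; rewrite xiE a0 mulr0.
have aybx j : a * y 0 j = b * x 0 j.
  by apply: (mulfI c0); rewrite !mulrA -xiE -yiE xy mulrC.
have /choice[w0 w0E] : forall j, exists e, x 0 j = e * a.
  by move=> j; apply: ab; exists (y 0 j); rewrite -aybx mulrC.
pose w : 'rV[S]_3 := \row_j w0 j.
have xE : x = a *: w by apply/rowP=> j; rewrite !mxE w0E mulrC.
have yE : y = b *: w.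
  by apply/rowP=> j; apply: (mulfI a0); rewrite aybx w0E !mxE; ring.
have wM : M w.
  apply/syzE; move/syzE/eqP: Mx; rewrite xE derZ mulf_eq0 (negPf a0) /= => /eqP.
  by [].
have wn0 : w != 0 by apply: contra_neq x0 => w00; rewrite xE w00 scaler0.
have [j wj] := syz_msize wM wn0.
have := homog_msize_le (xh j); rewrite {1}xE mxE msizeM //; last first.
  by apply: contraTneq wj => ->; rewrite msize0.
have /eqP am : (msize a != 0)%N by rewrite msize_poly_eq0.
move=> aw; have /eqP/msize_poly1P[e e0 aE] : msize a = 1%N.
  by move: (msize a) (msize (w 0 j)) am wj aw => m n; lia.
apply: xNy; apply/lspan1P; exists (b * e^-1%:MP).
rewrite yE xE aE; exact (@scale_constK R[i] e b w e0).
Qed.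

(** Syzygies of degree less than [d2] are multiples of the first generator, and
    two such multiples are dependent. *)
Lemma two_generators_le u v a b : M u -> M v -> homog_vec a u -> homog_vec b v ->
  triple (euler _) u v != 0 -> (d1 + d2 <= a + b)%N.
Proof.
move=> Mu Mv uh vh uv.
have u0 : u != 0 by apply: contra_neq uv => ->; apply: triple0m.
have v0 : v != 0 by apply: contra_neq uv => ->; apply: triplem0.
have d1a := syz_degree_ge Mu u0 uh; have d1b := syz_degree_ge Mv v0 vh.
have [ad|ad] := ltnP a d2; last by rewrite addnC leq_add.
have [bd|bd] := ltnP b d2; last by rewrite leq_add.
have /lspan1P[c uE] := syz_low Mu uh ad; have /lspan1P[e vE] := syz_low Mv vh bd.
by case/eqP: uv; rewrite uE vE tripleZZ.
Qed.

End TwoGenerators.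

Lemma two_generators d1 d2 ds : generator_degrees M [:: d1, d2 & ds] ->
  exists x y g, [/\ minimal_generators M [:: x, y & g], homog_vec d1 x,
    homog_vec d2 y, (forall r, r \in g -> exists2 d, (d2 <= d)%N & homog_vec d r) &
    (d1 <= d2)%N].
Proof.
case=> -[|x [|y g]] [gmin //= [sz] hom /andP[d12 dsort]].
exists x, y, g; split=> //; [exact: (hom 0%N) | exact: (hom 1%N) | ].
move=> r rg; exists (nth 0%N ds (index r g)).
  have /allP := order_path_min leq_trans dsort; apply.
  by rewrite mem_nth // sz index_mem.
have := hom (index r g).+2; rewrite /= nth_index //; apply.
by rewrite !ltnS index_mem.
Qed.

Lemma has_type_ge0 t : has_type f t -> 0 <= t.
Proof.
move=> [d1 [d2 [ds [/two_generators[x [y [g [gmin xh yh gh d12]]]] ->]]]].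
have xy := first_two_independent gmin xh yh gh d12.
have [/generatesP[gM _] _] := gmin.
have Mx : M x by apply: gM; rewrite mem_head.
have My : M y by apply: gM; rewrite !in_cons eqxx orbT.
have nil_red : reduced ([::] : seq 'rV[R[i]]_3) by [].
have H : (size s + 0 <= (d1 + d2).+1)%N.
  by apply: (saito_degree s_red nil_red _ Mx My xh yh _ _ xy).
by have [s0 _ _] := s_red; rewrite msize_arr_form //= subr_ge0; lia.
Qed.

Lemma has_type_le t u v a b : M u -> M v -> homog_vec a u -> homog_vec b v ->
  triple (euler _) u v != 0 -> has_type f t -> t + (size s)%:Z <= (a + b)%:Z + 1.
Proof.
move=> Mu Mv uh vh uv [d1 [d2 [ds [/two_generators[x [y [g [gmin xh yh gh d12]]]] ->]]]].
have := two_generators_le gmin xh yh gh d12 Mu Mv uh vh uv.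
by have [s0 _ _] := s_red; rewrite msize_arr_form //=; lia.
Qed.

Lemma has_type_generators t : has_type f t -> exists a b u v,
  [/\ M u, M v, homog_vec a u, homog_vec b v & triple (euler _) u v != 0] /\
  t + (size s)%:Z = (a + b)%:Z + 1.
Proof.
move=> [d1 [d2 [ds [/two_generators[x [y [g [gmin xh yh gh d12]]]] ->]]]].
have xy := first_two_independent gmin xh yh gh d12.
have [/generatesP[gM _] _] := gmin.
exists d1, d2, x, y; split; first split=> //.
- by apply: gM; rewrite mem_head.
- by apply: gM; rewrite !in_cons eqxx orbT.
by have [s0 _ _] := s_red; rewrite msize_arr_form //=; lia.
Qed.

Lemma has_type_exists u v : M u -> M v -> triple (euler _) u v != 0 ->
  exists t, has_type f t.
Proof.
move=> Mu Mv uv; have [ds dsP] := generator_degrees_exist.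
case: (dsP) => g [[/generatesP[_ gP] _] sz _ _].
case: ds dsP sz => [|d1 [|d2 ds]] dsP; last first.
- by move=> _; exists (d1%:Z + d2%:Z + 1 - ((msize f).-1)%:Z), d1, d2, ds.
- case: g gP => [|x [|y g]] // gP _; case/eqP: uv.
  have /lspan1P[c ->] := gP u Mu; have /lspan1P[e ->] := gP v Mv.
  exact: tripleZZ.
case: g gP => // gP _; case/eqP: uv; have /lspan_nil -> := gP u Mu.
exact: triple0m.
Qed.

End Arrangement.
End Generators.

(** * Lines and covectors *)

Lemma dotp_delta (F : comNzRingType) (u : 'rV[F]_3) j : dotp u (delta_mx 0 j) = u 0 j.
Proof. by move: j; apply: ord3P; rewrite dotpE !mxE /=; ring. Qed.

Lemma nonprop_separate (F : numFieldType) (a b : 'rV[F]_3) : nonprop a b ->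
  exists v, dotp a v = 0 /\ dotp b v != 0.
Proof.
move=> /rV0Pn[j abj]; exists (crossp (delta_mx 0 j) a); split.
  by rewrite !dotpE !mxE /=; ring.
suff -> : dotp b (crossp (delta_mx 0 j) a) = crossp a b 0 j by [].
have -> : dotp b (crossp (delta_mx 0 j) a) = dotp (crossp a b) (delta_mx 0 j).
  by rewrite !dotpE !mxE /=; ring.
exact: dotp_delta.
Qed.

Section Lines.
Variable R : realType.
Local Notation C := (R[i]).
Implicit Types (a b p q v : 'rV[C]_3) (L : line R).

(** Lines are planes through the origin of C^3, that is, kernels of nonzero
    covectors. *)
Definition dotp_hom a : 'Hom('rV[C]_3, 'rV[C]_1) := linfun (mulmxr a^T).
Definition annihilator a : {vspace 'rV[C]_3} := lker (dotp_hom a).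

Lemma mem_annihilator a v : (v \in annihilator a) = (dotp a v == 0).
Proof.
rewrite memv_ker lfunE /= dotpC; apply/eqP/eqP => [va|va].
  have := congr1 (fun M : 'M_1 => M 0 0) va; rewrite !mxE => va0.
  by apply: etrans va0; apply: eq_bigr => j _; rewrite mxE.
apply/rowP=> i; rewrite ord1 !mxE; apply: etrans va.
by apply: eq_bigr => j _; rewrite mxE.
Qed.

Lemma dim_annihilator a : a != 0 -> \dim (annihilator a) = 2%N.
Proof.
move=> a0; have := limg_ker_dim (dotp_hom a) fullv.
rewrite capfv -/(annihilator a) dimvf /dim /= => dimE.
have := dimvS (subvf (limg (dotp_hom a))); rewrite dimvf /dim /=.
have : (0 < \dim (limg (dotp_hom a)))%N.
  rewrite lt0n dimv_eq0; apply/eqP => im0; have /rV0Pn[j aj] := a0.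
  have : delta_mx 0 j \in annihilator a.
    by rewrite memv_ker -memv0 -im0 memv_img ?memvf.
  by rewrite mem_annihilator dotp_delta (negPf aj).
by move: dimE; rewrite !mul1n; move: (\dim (annihilator a)) (\dim (limg _)) => m n; lia.
Qed.

(** The cross product of a basis of the plane is a covector of the line. *)
Lemma line_annihilator L : exists2 a, a != 0 & val L = annihilator a.
Proof.
have dL : \dim (val L) = 2%N by case: L => V /= /eqP.
have := vbasisP (val L); move: (vbasis _) => b bL.
have [b1 [b2 bE]] : exists b1 b2, b = [:: b1; b2] :> seq 'rV[C]_3.
  by case: b {bL} => -[|b1 [|b2 [|b3 b]]] /=; rewrite dL // => _; exists b1, b2.
have bfree := basis_free bL; have bspan := span_basis bL.
rewrite bE free_cons free_cons nil_free span_nil memv0 andbT span_seq1 in bfree.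
have /andP[b12 b20] := bfree.
have c0 : crossp b1 b2 != 0.
  apply: contraNneq b12; rewrite crosspC => /eqP; rewrite oppr_eq0 => /eqP.
  by move=> /(crossp_eq0_scale b20)[k ->]; rewrite memvZ ?memv_line.
exists (crossp b1 b2) => //; apply/eqP.
rewrite eqEdim dim_annihilator // dL leqnn andbT.
apply/subvP => v; rewrite -bspan bE span_cons span_seq1.
move=> /memv_addP[_ /vlineP[k1 ->] [_ /vlineP[k2 ->] ->]].
by rewrite mem_annihilator; apply/eqP; rewrite !dotpE !mxE /=; ring.
Qed.

Lemma annihilator_line a : a != 0 -> exists L, val L = annihilator a.
Proof.
move=> a0; have dim2 : \dim (annihilator a) == 2%N by rewrite dim_annihilator.
by exists (exist _ (annihilator a) dim2).
Qed.

Lemma line_formP L : defines_line L (line_form L).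
Proof.
have [a a0 La] := line_annihilator L.
apply: (@xgetPex _ 0 (fun l => defines_line L l)); exists (lform a); split.
  exact: lform_homog.
by move=> v; rewrite La mem_annihilator lform_eval; split=> /eqP.
Qed.

(** The coordinates of [L] in the dual plane, up to a common factor. *)
Definition covec L : 'rV[C]_3 := \row_j (line_form L)@_U_(j).

Lemma line_form_covec L : line_form L = lform (covec L).
Proof. by have [Lh _] := line_formP L; apply: homog1_lform. Qed.

Lemma mem_line L v : v \in val L <-> dotp (covec L) v = 0.
Proof.
have [_ ->] := line_formP L; rewrite line_form_covec lform_eval; by [].
Qed.

Lemma covec_neq0 L : covec L != 0.
Proof.
apply/eqP => L0; have [a a0 La] := line_annihilator L.
have /rV0Pn[j aj] := a0.
have : delta_mx 0 j \in val L.
  by apply/mem_line; rewrite L0 dotpE !mxE; ring.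
by rewrite La mem_annihilator dotp_delta (negPf aj).
Qed.

Lemma covec_annihilator L a : a != 0 -> val L = annihilator a ->
  exists2 c, c != 0 & covec L = c *: a.
Proof.
move=> a0 La; have aL : crossp a (covec L) = 0.
  apply/eqP; apply: contraT => /nonprop_separate[v [av Lv]].
  have : v \in val L by rewrite La mem_annihilator av.
  by move=> /mem_line Lv0; rewrite Lv0 eqxx in Lv.
have [c cE] := crossp_eq0_scale a0 aL; exists c => //.
by have := covec_neq0 L; apply: contra_neq => c0; rewrite cE c0 scale0r.
Qed.

Lemma nonprop_covec L L' : L != L' -> nonprop (covec L) (covec L').
Proof.
apply: contra_neqT; rewrite negbK => /eqP LL'.
have [c cE] := crossp_eq0_scale (covec_neq0 L) LL'.
have c0 : c != 0.
  by have := covec_neq0 L'; apply: contra_neq => c0; rewrite cE c0 scale0r.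
apply/val_inj/vspaceP => v; apply/idP/idP => /mem_line vL; apply/mem_line.
  by rewrite cE dotpC dotpZr dotpC vL mulr0.
move: vL; rewrite cE dotpC dotpZr dotpC => /eqP.
by rewrite mulf_eq0 (negPf c0) => /eqP.
Qed.

Lemma reduced_covec (s : seq (line R)) : uniq s -> reduced (map covec s).
Proof.
move=> us; have inj : injective covec.
  move=> L L' LL'; apply/eqP; apply: contraTT (eqxx (covec L)) => /nonprop_covec.
  by rewrite /nonprop LL' crosspp eqxx.
split.
- by apply/mapP => -[L _ L0]; have := covec_neq0 L; rewrite -L0 eqxx.
- by rewrite map_inj_uniq.
move=> _ _ /mapP[L Ls ->] /mapP[L' Ls' ->] LL'; apply: nonprop_covec.
by apply: contra_neq LL' => ->.
Qed.

Lemma arr_poly_covec (A : line_arrangement R) (s : seq (line R)) :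
  perm_eq A s -> arr_poly A = arr_form (map covec s).
Proof.
move=> As; rewrite /arr_poly (perm_big _ As) /= /arr_form big_map.
by apply: eq_bigr => L _; apply: line_form_covec.
Qed.

End Lines.

(** * The two halves of the theorem *)

(** Either two double points of a line, or a triple point and another point of one
    of its lines: the multiplicities add up to at least 4. *)
Lemma two_multiple_points (F : numFieldType) (s : seq 'rV[F]_3) :
  reduced s -> (2 < size s)%N ->
  exists p q, nonprop p q /\
    (size (lines_off s p) + size (lines_off s q) + 4 <= 2 * size s)%N.
Proof.
case: s => [|a [|b [|c s]]] // [s0 us sN] _.
have [as_ bs cs] : [/\ a \in [:: a, b, c & s], b \in [:: a, b, c & s]
    & c \in [:: a, b, c & s]] by rewrite !inE !eqxx !orbT.
have [ab ac] : a != b /\ a != c.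
  by move: us; rewrite /= !inE !negb_or => /andP[/and3P[]].
have {}ab := sN a b as_ bs ab; have {}ac := sN a c as_ cs ac.
have cross0 (x y : 'rV[F]_3) : dotp x (crossp x y) = 0 /\ dotp y (crossp x y) = 0.
  by split; rewrite !dotpE !mxE /=; ring.
have [[a_p b_p] [a_q c_q]] := (cross0 a b, cross0 a c).
have offs (r : 'rV[F]_3) : ((dotp a r == 0%R) + (dotp b r == 0%R) + (dotp c r == 0%R)
    + size (lines_off [:: a, b, c & s] r) <= (size s).+3)%N.
  have : (size (lines_off s r) <= size s)%N by rewrite size_filter count_size.
  rewrite /lines_off /=; move: (size s) => n; do 3 case: eqP => _ /=; clear; lia.
have pt (x : 'rV[F]_3) : triple a b x != 0 -> nonprop (crossp a b) (crossp a x).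
  have a0 : a != 0 by apply: contraNneq s0 => <-.
  have /rV0Pn[j aj] := a0; move=> abx; apply/rV0Pn; exists j.
  by rewrite crossp_crossp mulf_neq0.
have [abc|abc] := eqVneq (triple a b c) 0.
  have /rV0Pn[j abj] := ab.
  pose q := crossp a (delta_mx 0 j); have [a_q' _] := cross0 a (delta_mx 0 j).
  exists (crossp a b), q; split.
    by apply: pt; rewrite /triple dotp_delta.
  have c_p : dotp c (crossp a b) = 0 by rewrite dotpC.
  have := offs (crossp a b); have := offs q; rewrite a_p b_p c_p a_q' !eqxx.
  rewrite [size [:: a, b, c & s]]/=.
  by move: (size (lines_off _ _)) (size (lines_off _ _)) (size s) => x y n; clear -x y n; lia.
exists (crossp a b), (crossp a c); split; first exact: pt.
have := offs (crossp a b); have := offs (crossp a c); rewrite a_p b_p a_q c_q !eqxx.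
rewrite [size [:: a, b, c & s]]/=.
by move: (size (lines_off _ _)) (size (lines_off _ _)) (size s) => x y n; clear -x y n; lia.
Qed.

Section Main.
Variable R : realType.
Local Notation C := (R[i]).

Lemma curve_typeP (f : {mpoly C[3]}) : (exists t, has_type f t) ->
  has_type f (curve_type f).
Proof. exact: (@xgetPex _ (-1) (fun t => has_type f t)). Qed.

(** The syzygies of the points [p] and [q] bound the degrees of the first two
    generators; their existence also makes the type well defined. *)
Lemma arr_type_le (A : line_arrangement R) (s : seq 'rV[C]_3) p q :
  reduced s -> (0 < size s)%N -> arr_poly A = arr_form s -> nonprop p q ->
  has_type (arr_poly A) (arr_type A) /\
  arr_type A + (size s)%:Z <= (size (lines_off s p) + size (lines_off s q))%:Z + 1.
Proof.
move=> s_red s_nnil AE pq; have indep := point_syzygy_independent s_red s_nnil pq.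
have Mp : jacobian_syzygy (arr_form s) (point_syzygy s p) by apply: point_syzygy_der.
have Mq : jacobian_syzygy (arr_form s) (point_syzygy s q) by apply: point_syzygy_der.
have At : has_type (arr_form s) (arr_type A).
  rewrite /arr_type AE; apply: curve_typeP.
  exact: (has_type_exists Mp Mq indep).
rewrite AE; split=> //.
by apply: (has_type_le s_red s_nnil Mp Mq _ _ indep At) => j; apply: point_syzygy_homog.
Qed.

Lemma type_bounds (A : line_arrangement R) : (3 <= arr_deg A)%N ->
  0 <= arr_type A <= (arr_deg A)%:Z - 3.
Proof.
move=> A3; have s_red := reduced_covec (fset_uniq A).
have AE := arr_poly_covec (perm_refl A).
have sA : size (map (@covec R) A) = arr_deg A by rewrite size_map.
have [|p [q [pq pqs]]] := two_multiple_points s_red; first by rewrite sA.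
have s_nnil : (0 < size (map (@covec R) A))%N by rewrite sA; lia.
have [At tle] := arr_type_le s_red s_nnil AE pq; rewrite AE in At.
rewrite (has_type_ge0 s_red s_nnil At) /=.
by move: tle pqs; rewrite sA; move: (size _) (size _) => m n; lia.
Qed.

End Main.

(** The lines of the pencil meet in the point (0 : 0 : 1).  The other ones are
    tangent to a conic, so that no three of them are concurrent.  The opposite
    signs ensure that no line of the pencil passes through the intersection of two
    of the others. *)
Section Example.
Variable F : numFieldType.

Definition pencil_covec (i : nat) : 'rV[F]_3 := \row_j [:: 1; - i%:R; 0]`_j.
Definition conic_covec (x : nat) : 'rV[F]_3 := \row_j [:: 1; x%:R; x%:R ^+ 2]`_j.

Lemma triple_conic x y z : triple (conic_covec x) (conic_covec y) (conic_covec z) =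
  (y%:R - x%:R) * (z%:R - x%:R) * (z%:R - y%:R).
Proof. by rewrite /triple !dotpE !mxE /=; ring. Qed.

Lemma triple_conic_pencil x i j :
  triple (conic_covec x) (pencil_covec i) (pencil_covec j) = x%:R ^+ 2 * (i%:R - j%:R).
Proof. by rewrite /triple !dotpE !mxE /=; ring. Qed.

Lemma triple_conic_mixed x i z :
  triple (conic_covec x) (pencil_covec i) (conic_covec z) =
  (x%:R - z%:R) * (x * z + i * (x + z))%:R.
Proof. by rewrite /triple !dotpE !mxE /= natrD !natrM natrD; ring. Qed.

Variables m k : nat.

Definition pencil := [seq pencil_covec i | i <- iota 0 m].
Definition conic := [seq conic_covec x | x <- iota 1 k].

Lemma natr_neq (x y : nat) : x != y -> x%:R - y%:R != 0 :> F.
Proof. by rewrite subr_eq0 eqr_nat. Qed.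

Lemma pencilP a : a \in pencil -> exists i, a = pencil_covec i.
Proof. by move=> /mapP[i _ ->]; exists i. Qed.

Lemma conicP a : a \in conic -> exists2 x, (0 < x)%N & a = conic_covec x.
Proof. by move=> /mapP[x]; rewrite mem_iota => /andP[x0 _] ->; exists x. Qed.

Lemma conic_pencil_neq x i : (0 < x)%N -> conic_covec x != pencil_covec i.
Proof.
rewrite lt0n => x0; apply/eqP => /(congr1 (fun a : 'rV[F]_3 => a 0 o2)).
by rewrite !mxE => /eqP; rewrite expf_eq0 pnatr_eq0 (negPf x0).
Qed.

Lemma example_uniq : uniq (pencil ++ conic).
Proof.
rewrite cat_uniq; apply/and3P; split.
- rewrite map_inj_uniq ?iota_uniq // => i j /(congr1 (fun a : 'rV[F]_3 => a 0 o1)).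
  by rewrite !mxE => /oppr_inj /eqP; rewrite eqr_nat => /eqP.
- apply/hasPn => _ /conicP[x x0 ->]; apply/negP => /pencilP[i /eqP].
  by apply/negP/conic_pencil_neq.
rewrite map_inj_uniq ?iota_uniq // => x y /(congr1 (fun a : 'rV[F]_3 => a 0 o1)).
by rewrite !mxE => /eqP; rewrite eqr_nat => /eqP.
Qed.

Lemma example_generic : {in conic & pencil ++ conic & pencil ++ conic, forall a b c,
  a != b -> a != c -> b != c -> triple a b c != 0}.
Proof.
have mixed x i z : (0 < x)%N -> (0 < z)%N -> conic_covec x != conic_covec z ->
    triple (conic_covec x) (pencil_covec i) (conic_covec z) != 0.
  move=> x0 z0 xz; rewrite triple_conic_mixed mulf_neq0 ?natr_neq //.
    by apply: contra_neq xz => ->.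
  by rewrite pnatr_eq0 -lt0n addn_gt0 muln_gt0 x0 z0.
move=> _ b c /conicP[x x0 ->].
rewrite !mem_cat => /orP[/pencilP[i ->]|/conicP[y y0 ->]];
  move=> /orP[/pencilP[j ->]|/conicP[z z0 ->]] xb xc bc.
- rewrite triple_conic_pencil mulf_neq0 //; last first.
    by apply: natr_neq; apply: contra_neq bc => ->.
  by rewrite expf_neq0 // pnatr_eq0 -lt0n.
- exact: mixed.
- by rewrite tripleC oppr_eq0 mixed.
rewrite triple_conic !mulf_neq0 ?natr_neq //.
- by apply: contra_neq xb => ->.
- by apply: contra_neq xc => ->.
by apply: contra_neq bc => ->.
Qed.

Lemma example_nonprop : {in pencil ++ conic &, forall a b, a != b -> nonprop a b}.
Proof.
have mixed x i : (0 < x)%N -> nonprop (conic_covec x) (pencil_covec i).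
  move=> x0; apply/rV0Pn; exists o1; rewrite !mxE /= mulr1 mul1r subr0.
  by rewrite expf_neq0 // pnatr_eq0 -lt0n.
move=> a b; rewrite !mem_cat.
move=> /orP[/pencilP[i ->]|/conicP[x x0 ->]] /orP[/pencilP[j ->]|/conicP[y y0 ->]] ab.
- apply/rV0Pn; exists o2; rewrite !mxE /= mul1r mulr1 opprK addrC natr_neq //.
  by apply: contra_neq ab => ->.
- by rewrite nonprop_sym mixed.
- exact: mixed.
apply/rV0Pn; exists o2; rewrite !mxE /= mul1r mulr1 natr_neq //.
by apply: contra_neq ab => ->.
Qed.

End Example.

(** Here [m] lines belong to the pencil and [t.+1] lines are in general position.
    The lower bound on degrees is attained by the syzygies of the centre [p] of
    the pencil and of a double point [q]. *)
Lemma type_realized (R : realType) (t m : nat) : (1 < m)%N ->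
  exists A : line_arrangement R, arr_type A = t /\ arr_deg A = (m + t.+1)%N.
Proof.
move=> m1; pose b1 := pencil R[i] m; pose b2 := conic R[i] t.+1.
pose b := b1 ++ b2; have b_uniq : uniq b := example_uniq R[i] m t.+1.
have bN : {in b &, forall x y, x != y -> nonprop x y} := @example_nonprop R[i] m t.+1.
have b_neq0 a : a \in b -> a != 0.
  move=> ab; apply/rV0Pn; exists o0; move: ab; rewrite mem_cat.
  by move=> /orP[/pencilP[i ->]|/conicP[x _ ->]]; rewrite mxE oner_neq0.
have a1 : pencil_covec R[i] 0 \in b1.
  by apply: map_f; rewrite mem_iota /= ltnW.
have a2 : conic_covec R[i] 1 \in b2.
  by apply: map_f; rewrite mem_iota.
have b12 x : (x \in b1) || (x \in b2) -> x \in b by rewrite mem_cat.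
have /choice[lin linP] : forall a, exists L : line R, a \in b -> val L = annihilator a.
  move=> a; have [ab|] := boolP (a \in b).
    by have [L LE] := annihilator_line (b_neq0 _ ab); exists L.
  have a1b : pencil_covec R[i] 0 \in b by rewrite b12 ?a1.
  by have [L _] := annihilator_line (b_neq0 _ a1b); exists L.
have lin_inj : {in b &, injective lin}.
  move=> x y xb yb xy; apply/eqP; apply: contraT => /(bN x y xb yb).
  move=> /nonprop_separate[v [xv yv]].
  have : v \in annihilator x by rewrite mem_annihilator xv.
  by rewrite -linP // xy linP // mem_annihilator (negPf yv).
have /choice[k kP] : forall a, exists c, a \in b -> c != 0 /\ covec (lin a) = c *: a.
  move=> a; have [ab|] := boolP (a \in b); last by exists 0.
  by have [c c0 cE] := covec_annihilator (b_neq0 _ ab) (linP _ ab); exists c.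
pose ls := map lin b; have ls_uniq : uniq ls by rewrite map_inj_in_uniq.
pose A : line_arrangement R := [fset L in ls]%fset.
have A_perm : perm_eq A ls.
  by apply: uniq_perm; rewrite ?fset_uniq // => L; rewrite !inE.
pose cov a := covec (lin a); pose s1 := map cov b1; pose s2 := map cov b2.
have sE : map (@covec R) ls = s1 ++ s2 by rewrite /ls -map_comp map_cat.
have s_red : reduced (s1 ++ s2) by rewrite -sE; apply: reduced_covec.
have AE : arr_poly A = arr_form (s1 ++ s2) by rewrite -sE; apply: arr_poly_covec.
have [sz1 sz2] : size s1 = m /\ size s2 = t.+1 by rewrite !size_map !size_iota.
have s_size : size (s1 ++ s2) = (m + t.+1)%N by rewrite size_cat sz1 sz2.
have s_nnil : (0 < size (s1 ++ s2))%N by rewrite s_size addnS.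
have covP a : a \in s1 ++ s2 -> exists2 x, x \in b & a = k x *: x /\ a = cov x.
  rewrite -map_cat => /mapP[x xb ->]; exists x => //.
  by have [_ E] := kP x xb; rewrite /cov E.
exists A; split; last by rewrite /arr_deg (perm_size A_perm) size_map size_cat
  !size_map !size_iota.
have generic : {in s2 & s1 ++ s2 & s1 ++ s2, forall x y z,
    x != y -> x != z -> y != z -> triple x y z != 0}.
  move=> _ y z /mapP[x xb2 ->] /covP[y0 y0b [yE yE']] /covP[z0 z0b [zE zE']].
  have xb : x \in b by rewrite mem_cat xb2 orbT.
  have [kx xE] := kP x xb; have [ky _] := kP y0 y0b; have [kz _] := kP z0 z0b.
  move=> xy xz yz; rewrite /cov xE yE zE tripleZ3 !mulf_neq0 //.
  apply: (example_generic xb2 y0b z0b).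
  - by apply: contra_neq xy => E; rewrite yE' E.
  - by apply: contra_neq xz => E; rewrite zE' E.
  by apply: contra_neq yz => E; rewrite yE' zE' E.
(* [q] lies on the lines [pencil_covec 0] and [conic_covec 1] *)
pose p : 'rV[R[i]]_3 := \row_j [:: 0; 0; 1]`_j.
pose q : 'rV[R[i]]_3 := \row_j [:: 0; -1; 1]`_j.
have pq : nonprop p q.
  apply/rV0Pn; exists o0; rewrite !mxE /= mul0r mul1r opprK add0r; exact: oner_neq0.
have cov0 x r : x \in b -> dotp x r = 0 -> dotp (cov x) r = 0.
  by move=> xb xr; have [_ E] := kP x xb; rewrite /cov E dotpC dotpZr dotpC xr mulr0.
have off_p : (size (lines_off (s1 ++ s2) p) <= t.+1)%N.
  rewrite /lines_off filter_cat size_cat -[t.+1]add0n leq_add //; last first.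
    by rewrite -sz2 size_filter count_size.
  rewrite leqn0 size_filter -leqn0 leqNgt -has_count; apply/hasPn => _ /mapP[x xb1 ->].
  rewrite negbK cov0 ?mem_cat ?xb1 //.
  by have [i ->] := pencilP xb1; rewrite dotpE !mxE /=; ring.
have off_q : (size (lines_off (s1 ++ s2) q) + 2 <= m + t.+1)%N.
  have two : (2 <= size [seq a <- s1 ++ s2 | dotp a q == 0%R])%N.
    rewrite filter_cat size_cat !size_filter -[2%N]/(1 + 1)%N leq_add //.
      rewrite -has_count; apply/hasP; exists (cov (pencil_covec R[i] 0)).
        exact: map_f.
      rewrite cov0 ?b12 ?a1 //; rewrite dotpE !mxE /=; ring.
    rewrite -has_count; apply/hasP; exists (cov (conic_covec R[i] 1)).
      exact: map_f.
    rewrite cov0 ?b12 ?a2 ?orbT //; rewrite dotpE !mxE /=; ring.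
  rewrite -s_size -(count_predC (fun a => dotp a q == 0) (s1 ++ s2)) addnC.
  by rewrite -!size_filter leq_add.
have [At tle] := arr_type_le s_red s_nnil AE pq; rewrite AE in At.
have [d [e [u [v [[Mu Mv uh vh uv] tE]]]]] := has_type_generators s_red s_nnil At.
have := pencil_generic_degree s_red _ generic Mu Mv uh vh uv.
rewrite sz1 sz2 s_size in tle tE *.
by move=> /(_ m1); move: tle tE off_p off_q; move: (size _) (size _) => x y; clear -x y; lia.
Qed.

Theorem corollary1p8 (R : realType) :
  (forall A : line_arrangement R, (3 <= arr_deg A)%N ->
     0 <= arr_type A <= (arr_deg A)%:Z - 3) /\
  (forall t d : int, 0 <= t <= d - 3 ->
     exists A : line_arrangement R,
       arr_type A = t /\ (arr_deg A)%:Z = d).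
Proof.
split=> [A A3|t d td]; first exact: type_bounds.
have [tn tE] : exists n : nat, t = n%:Z by exists `|t|%N; lia.
have [m [m1 dE]] : exists m : nat, (1 < m)%N /\ d = (m + tn.+1)%:Z.
  by exists `|d - tn.+1%:Z|%N; split; lia.
by have [A [At Ad]] := type_realized R tn m1; exists A; rewrite At Ad tE dE.
Qed.
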